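(* Let $X$ be a regular Fréchet sequence algebra for the Cauchy product and let $w=(w_n)_{n\ge1}$ be an admissible weight sequence for $X$. Assume that (a) $\sum_{n\ge1}(w_1\cdots w_n)^{-1}e_n$ converges unconditionally in $X$; (b) for all integers $m\ge2$, there exists $c\in(0,1)$ such that $$\lim_{\sigma\to+\infty}\ \sup_{z\in c_{00}\cap B_{\ell_\infty}}\left\|\sum_{n\ge c\sigma}\frac{z_n(w_1\cdots w_{m\sigma})^{(m-1)/m}}{w_1\cdots w_{(m-1)\sigma+n}}e_n\right\|=0,$$ where $\sigma$ runs over the positive integers. Then $B_w$ admits an upper frequently hypercyclic algebra.
   Context: $\mathbb N=\{1,2,\dots\}$, $\mathbb N_0=\mathbb N\cup\{0\}$, $\omega=\mathbb C^{\mathbb N_0}$, and $e_n\in\omega$ is the sequence with $1$ in position $n$ and $0$ elsewhere. A Fréchet sequence algebra is a subspace $X$ of $\omega$ which is a Fréchet space (complete metrizable) for the topology induced by a non-decreasing sequence of seminorms $(\|\cdot\|_q)_{q\ge1}$, such that convergence in $X$ implies coordinatewise convergence, endowed with a product satisfying $\|x\cdot y\|_q\le\|x\|_q\|y\|_q$ for all $x,y\in X$, $q\ge1$. The Cauchy (convolution) product is $(x\cdot y)_n=\sum_{j=0}^nx_jy_{n-j}$. A Fréchet sequence algebra $X$ for the Cauchy product is called regular if: (1) $X$ admits a continuous norm (a norm on $X$ bounded by $C\|\cdot\|_q$ for some $q\ge1$, $C>0$); (2) $(e_n)_{n\ge0}$ is a Schauder basis of $X$; (3) for any $r\ge1$ there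 exist $q\ge1$ and $C>0$ such that $\|e_n\|_r\cdot\|e_k\|_r\le C\|e_{n+k}\|_q$ for all $n,k\ge0$. For a sequence $w=(w_n)_{n\ge1}$ of nonzero complex numbers, $B_w(x_0,x_1,\dots)=(w_1x_1,w_2x_2,\dots)$; $w$ is admissible for $X$ if $B_w$ is a continuous linear operator from $X$ to $X$. $\|\cdot\|$ denotes the $F$-norm $\|x\|=\sum_{p\ge1}2^{-p}\min(1,\|x\|_p)$, which defines the topology of $X$. $c_{00}$ is the set of finitely supported sequences in $\omega$ and $B_{\ell_\infty}$ is the unit ball $\{z\in\omega:\sup_n|z_n|\le1\}$. Fractional powers of complex numbers denote any determination. A series converges unconditionally if all its rearrangements converge. A vector $x\in X$ is upper frequently hypercyclic for $T$ if, for every non-empty open $U\subset X$, the set $\{n\in\mathbb N:T^nx\in U\}$ has positive upper density. An upper frequently hypercyclic algebra for $T$ is a subalgebra of $X$, different from $\{0\}$ and not required to be unital, all of whose nonzero elements are upper frequently hypercyclic vectors for $T$. *)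

(* Defs.v *)
From HB Require Import structures.
From mathcomp Require Import all_boot all_order all_algebra.
From mathcomp Require Import all_classical all_reals all_analysis.
From mathcomp Require Import complex.

Set Implicit Arguments.
Unset Strict Implicit.
Unset Printing Implicit Defensive.

Import Order.TTheory GRing.Theory Num.Theory.
Import numFieldNormedType.Exports.
Import ComplexField.Normc.

Local Open Scope classical_set_scope.
Local Open Scope ring_scope.

(* R[i]^o rather than R[i]: the scalars of omega R are complex, whereas R[i]
   alone is declared as a module over R. *)
Definition omega (R : realType) := nat -> (R[i])^o.

Section SequenceSpaces.
Variable R : realType.
Implicit Types (x y z : omega R) (X : set (omega R)).

Definition ebasis (n : nat) : omega R := fun k => (k == n)%:R.

Definition cauchy_product x y : omega R :=
  fun n => \sum_(j < n.+1) x j * y (n - j)%N.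

Definition subspace_of_omega X :=
  [/\ X 0, (forall x y, X x -> X y -> X (x + y))
    & forall (a : R[i]) x, X x -> X (a *: x)].

Definition seminorm_on X (p : omega R -> R) :=
  [/\ (forall x, X x -> 0 <= p x),
      (forall x y, X x -> X y -> p (x + y) <= p x + p y)
    & forall (a : R[i]) x, X x -> p (a *: x) = normc a * p x].

Definition norm_on X (p : omega R -> R) :=
  seminorm_on X p /\ forall x, X x -> p x = 0 -> x = 0.

(* In everything below, the seminorm with index q : nat is the one that is
   usually written with index q + 1 >= 1. Seminorms are functions on omega R,
   but only their values on the carrier are meaningful. *)
Definition cvg_seminorms (p : nat -> omega R -> R) (u : nat -> omega R) x :=
  forall q, (fun k => p q (u k - x)) @ \oo --> (0 : R).

Definition cauchy_seminorms (p : nat -> omega R -> R) (u : nat -> omega R) :=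
  forall q (eps : R), 0 < eps ->
    exists N : nat, forall k l, (N <= k)%N -> (N <= l)%N ->
      p q (u k - u l) < eps.

(* Fréchet sequence algebra for the Cauchy product. A countable family of
   seminorms induces a metrizable topology iff it separates points, and the
   induced uniformity is complete iff Cauchy sequences converge. *)
Record frechet_seq_algebra := FrechetSeqAlgebra {
  carrier : set (omega R) ;
  seminorm : nat -> omega R -> R ;
  carrier_subspace : subspace_of_omega carrier ;
  seminormP : forall q, seminorm_on carrier (seminorm q) ;
  seminorm_nondecreasing : forall q r x, (q <= r)%N -> carrier x ->
    seminorm q x <= seminorm r x ;
  seminorm_separating : forall x, carrier x ->
    (forall q, seminorm q x = 0) -> x = 0 ;
  seminorm_complete : forall u : nat -> omega R, (forall k, carrier (u k)) ->
    cauchy_seminorms seminorm u ->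
    exists2 x, carrier x & cvg_seminorms seminorm u x ;
  cvg_coordinatewise : forall (u : nat -> omega R) x,
    (forall k, carrier (u k)) -> carrier x -> cvg_seminorms seminorm u x ->
    forall n, (fun k => normc (u k n - x n)) @ \oo --> (0 : R) ;
  carrier_cauchy_product : forall x y, carrier x -> carrier y ->
    carrier (cauchy_product x y) ;
  seminorm_cauchy_product : forall q x y, carrier x -> carrier y ->
    seminorm q (cauchy_product x y) <= seminorm q x * seminorm q y }.

End SequenceSpaces.

Section FrechetSequenceAlgebras.
Variables (R : realType) (X : frechet_seq_algebra R).
Implicit Types (x y : omega R) (T : omega R -> omega R).

Definition cvg_in (u : nat -> omega R) x :=
  [/\ (forall k, carrier X (u k)), carrier X x
    & cvg_seminorms (seminorm X) u x].

(* Since the seminorms are non-decreasing, the balls of a single seminorm form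
   a basis of the topology. *)
Definition open_in (U : set (omega R)) :=
  U `<=` carrier X /\ forall x, U x -> exists q, exists2 eps : R, 0 < eps &
    forall y, carrier X y -> seminorm X q (y - x) < eps -> U y.

Definition Fnorm x : R :=
  limn (series (fun q => 2^-1 ^+ q.+1 * Num.min 1 (seminorm X q x))).

Definition schauder_basis (b : nat -> omega R) :=
  (forall n, carrier X (b n)) /\
  forall x, carrier X x -> exists! a : nat -> R[i],
    cvg_in (fun N => \sum_(0 <= n < N) a n *: b n) x.

Definition admits_continuous_norm :=
  exists2 p, norm_on (carrier X) p &
    exists q, exists2 C : R, 0 < C &
      forall x, carrier X x -> p x <= C * seminorm X q x.

Definition regular_algebra :=
  [/\ admits_continuous_norm,
      schauder_basis (@ebasis R)
    & forall r, exists q, exists2 C : R, 0 < C & forall n k,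
        seminorm X r (ebasis R n) * seminorm X r (ebasis R k)
          <= C * seminorm X q (ebasis R (n + k))].

Definition continuous_operator T :=
  [/\ (forall x, carrier X x -> carrier X (T x)),
      (forall (a : R[i]) x y, carrier X x -> carrier X y ->
         T (a *: x + y) = a *: T x + T y)
    & forall U, open_in U -> open_in (carrier X `&` T @^-1` U)].

Definition unconditionally_convergent (u : nat -> omega R) :=
  forall s : nat -> nat, bijective s ->
    exists x, cvg_in (fun N => \sum_(0 <= k < N) u (s k)) x.

Definition upper_density (A : set nat) : \bar R :=
  limn_esup (fun N => ((\sum_(1 <= n < N.+1) \1_A n) / N%:R)%:E).

Definition upper_frequently_hypercyclic T x :=
  carrier X x /\ forall U, open_in U -> U !=set0 ->
    (0 < upper_density [set n | U (iter n T x)])%E.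

Definition subalgebra (A : set (omega R)) :=
  [/\ A `<=` carrier X, subspace_of_omega A
    & forall x y, A x -> A y -> A (cauchy_product x y)].

Definition upper_frequently_hypercyclic_algebra T (A : set (omega R)) :=
  [/\ subalgebra A, A <> [set 0]
    & forall x, A x -> x <> 0 -> upper_frequently_hypercyclic T x].

End FrechetSequenceAlgebras.

Section WeightedShifts.
Variable R : realType.
Implicit Types (w : nat -> R[i]) (X : frechet_seq_algebra R).

(* Weight sequences are indexed by n >= 1; the value w 0 is never used. *)
Definition wprod w (n : nat) : R[i] := \prod_(1 <= i < n.+1) w i.

Definition weighted_shift w (x : omega R) : omega R :=
  fun n => w n.+1 * x n.+1.

Definition admissible X w :=
  (forall n, (1 <= n)%N -> w n != 0) /\
  continuous_operator X (weighted_shift w).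

(* b is a determination of the fractional power a^(p/q). *)
Definition is_fracpow (p q : nat) (a b : R[i]) :=
  exists2 c : R[i], c ^+ q = a & b = c ^+ p.

Definition c00 : set (omega R) := [set z | finite_set [set n | z n != 0]].

Definition ball_linfty : set (omega R) := [set z | forall n, normc (z n) <= 1].

(* b stands for the chosen value of (w_1...w_(m sigma))^((m-1)/m). As z has
   finite support, only finitely many terms of the sum are nonzero. *)
Definition tail_sum w (m : nat) (c : R) (sigma : nat) (b : R[i])
    (z : omega R) : omega R :=
  \sum_(n \in [set n : nat | c * sigma%:R <= n%:R])
    ((z n * b / wprod w (m.-1 * sigma + n)) : R[i]) *: ebasis R n.

End WeightedShifts.

Arguments c00 R : clear implicits.
Arguments ball_linfty R : clear implicits.

(* Main.v *)
(* Write W_n = w_1...w_n. By a Baire category argument it suffices to find, for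
   m >= 2 and a polynomial target y, perturbations P of any given vector for
   which B_w^p(P^m) is close to y and B_w^p(P^k) is close to 0 for 2 <= k < m,
   for a set of p <= N whose proportion is bounded below by a constant
   depending on m and y (and on the precision) only. A generic u then has
   this property along arbitrarily large N, and the polynomials in u without
   constant and linear terms form the algebra: the highest power of u dominates.

   The perturbation is x + D + e X^s, where e^m = 1/W_(m s) and D lives in
   degrees [G, g) with c s <= G and 2g = s + G. In degrees >= (m-1)s + G only
   m e^(m-1) X^((m-1)s) D and e^m X^(ms) contribute to its m-th power. The
   coefficients of D are chosen so that, K being a large period, B_w^p of the
   first term is y plus a small tail for all p = (m-1)s + k K in
   [(m-1)s + G, (m-1)s + g). Assumption (b) makes D and e X^s small, and (a)
   makes the tails small. *)
Require Import Defs.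
From mathcomp Require Import all_boot all_order all_algebra.
From mathcomp Require Import all_classical all_reals all_analysis.
From mathcomp Require Import complex.
From mathcomp Require Import ring lra zify.

Set Implicit Arguments.
Unset Strict Implicit.
Unset Printing Implicit Defensive.

Import Order.TTheory GRing.Theory Num.Theory.
Import numFieldNormedType.Exports.
Import ComplexField.Normc.

Local Open Scope classical_set_scope.
Local Open Scope ring_scope.

(** * Carrier and seminorm calculus *)

Section Seminorms.
Variables (R : realType) (X : frechet_seq_algebra R).
Implicit Types (x y z : omega R).

Lemma carrier0 : carrier X 0.
Proof. by case: (carrier_subspace X). Qed.

Lemma carrierD x y : carrier X x -> carrier X y -> carrier X (x + y).
Proof. by case: (carrier_subspace X) => _ + _; apply. Qed.

Lemma carrierZ (a : R[i]) x : carrier X x -> carrier X (a *: x).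
Proof. by case: (carrier_subspace X) => _ _; apply. Qed.

Lemma carrierN x : carrier X x -> carrier X (- x).
Proof. by rewrite -scaleN1r; apply: carrierZ. Qed.

Lemma carrierB x y : carrier X x -> carrier X y -> carrier X (x - y).
Proof. by move=> xX yX; apply: carrierD => //; apply: carrierN. Qed.

Lemma carrier_sum (I : Type) (r : seq I) (P : pred I) (F : I -> omega R) :
  (forall i, P i -> carrier X (F i)) -> carrier X (\sum_(i <- r | P i) F i).
Proof.
by move=> FX; elim/big_ind: _ => //; [exact: carrier0|exact: carrierD].
Qed.

Lemma seminorm_ge0 q x : carrier X x -> 0 <= seminorm X q x.
Proof. by case: (seminormP X q) => + _ _; apply. Qed.

Lemma seminormD q x y : carrier X x -> carrier X y ->
  seminorm X q (x + y) <= seminorm X q x + seminorm X q y.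
Proof. by case: (seminormP X q) => _ + _; apply. Qed.

Lemma seminormZ q (a : R[i]) x : carrier X x ->
  seminorm X q (a *: x) = normc a * seminorm X q x.
Proof. by case: (seminormP X q) => _ _; apply. Qed.

Lemma seminorm0 q : seminorm X q 0 = 0.
Proof.
have := seminormZ q 0 carrier0.
by rewrite scale0r normc0 mul0r.
Qed.

Lemma seminormN q x : carrier X x -> seminorm X q (- x) = seminorm X q x.
Proof. by move=> xX; rewrite -scaleN1r seminormZ// normcN normc1 mul1r. Qed.

Lemma seminorm_distC q x y : carrier X x -> carrier X y ->
  seminorm X q (x - y) = seminorm X q (y - x).
Proof. by move=> xX yX; rewrite -opprB seminormN//; apply: carrierB. Qed.

Lemma seminorm_triangle q y x z : carrier X x -> carrier X y -> carrier X z ->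
  seminorm X q (x - z) <= seminorm X q (x - y) + seminorm X q (y - z).
Proof.
move=> xX yX zX; have -> : x - z = (x - y) + (y - z) by rewrite addrA subrK.
by apply: seminormD; apply: carrierB.
Qed.

Lemma seminorm_sum q (I : Type) (r : seq I) (P : pred I) (F : I -> omega R) :
  (forall i, P i -> carrier X (F i)) ->
  seminorm X q (\sum_(i <- r | P i) F i) <=
    \sum_(i <- r | P i) seminorm X q (F i).
Proof.
move=> FX; elim: r => [|i r IH]; first by rewrite !big_nil seminorm0.
rewrite !big_cons; case: ifP => // Pi.
apply: le_trans (seminormD _ _ _) _; [exact: FX|exact: carrier_sum|].
by rewrite lerD2l.
Qed.

End Seminorms.

(** * Formal power series: Cauchy product, powers and polynomial calculus *)

Section Powers.
Variable R : realType.
Implicit Types (x y z : omega R) (P Q : {poly R[i]}).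

Definition omega_of_poly P : omega R := fun n => P`_n.

Definition truncation x N : {poly R[i]} := \poly_(i < N) x i.

(** Coefficient [n] of a product depends only on the entries up to [n], so the ring laws of the
    Cauchy product can be imported from polynomials. *)
Lemma cauchy_product_trunc x y N n : (n < N)%N ->
  cauchy_product x y n = (truncation x N * truncation y N)`_n.
Proof.
move=> nN; rewrite coefM; apply: eq_bigr => j _.
have jN : (j < N)%N by apply: leq_trans (ltn_ord j) nN.
have njN : (n - j < N)%N by apply: leq_ltn_trans nN; exact: leq_subr.
by rewrite /truncation !coef_poly jN njN.
Qed.

Lemma omega_of_polyM P Q :
  omega_of_poly (P * Q) = cauchy_product (omega_of_poly P) (omega_of_poly Q).
Proof. by apply/funext => n; rewrite /omega_of_poly coefM. Qed.

Lemma omega_of_polyD P Q :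
  omega_of_poly (P + Q) = omega_of_poly P + omega_of_poly Q.
Proof. by apply/funext => n; rewrite /omega_of_poly coefD. Qed.

Lemma omega_of_polyB P Q :
  omega_of_poly (P - Q) = omega_of_poly P - omega_of_poly Q.
Proof. by apply/funext => n; rewrite /omega_of_poly coefB. Qed.

Lemma omega_of_polyZ (a : R[i]) P : omega_of_poly (a *: P) = a *: omega_of_poly P.
Proof. by apply/funext => n; rewrite /omega_of_poly coefZ. Qed.

Lemma omega_of_polyXn n : omega_of_poly 'X^n = ebasis R n.
Proof. by apply/funext => k; rewrite /omega_of_poly coefXn. Qed.

Lemma omega_of_poly_sum P N : (size P <= N)%N ->
  omega_of_poly P = \sum_(0 <= n < N) P`_n *: ebasis R n.
Proof.
move=> PN; rewrite big_mkord; apply/funext => k; rewrite fct_sumE.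
have [kN|Nk] := ltnP k N; last first.
  rewrite big1 ?/omega_of_poly ?nth_default//; first exact: leq_trans Nk.
  move=> i _; rewrite fctE /ebasis gtn_eqF ?scaler0//.
  exact: leq_trans (ltn_ord i) Nk.
rewrite (bigD1 (Ordinal kN))//= big1 ?addr0.
  by rewrite fctE /ebasis eqxx /GRing.scale/= mulr1.
move=> i /negbTE neq; rewrite fctE /ebasis.
by have -> : (k == i) = false; rewrite ?scaler0// eq_sym.
Qed.

Lemma cauchy_productC x y : cauchy_product x y = cauchy_product y x.
Proof.
by apply/funext => n; rewrite !(@cauchy_product_trunc _ _ n.+1)// mulrC.
Qed.

Lemma cauchy_productA x y z :
  cauchy_product x (cauchy_product y z) = cauchy_product (cauchy_product x y) z.
Proof.
apply/funext => n.
have tr a b j : (j <= n)%N -> (truncation (cauchy_product a b) n.+1)`_j =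
    (truncation a n.+1 * truncation b n.+1)`_j.
  by move=> jn; rewrite coef_poly ltnS jn (@cauchy_product_trunc _ _ n.+1).
rewrite !(@cauchy_product_trunc _ _ n.+1)//.
transitivity (truncation x n.+1 * (truncation y n.+1 * truncation z n.+1))`_n.
  by rewrite !coefM; apply: eq_bigr => j _; rewrite tr// leq_subr.
by rewrite mulrA !coefM; apply: eq_bigr => j _; rewrite tr// -ltnS.
Qed.

Lemma cauchy_productDl x y z :
  cauchy_product (x + y) z = cauchy_product x z + cauchy_product y z.
Proof.
apply/funext => n; rewrite /cauchy_product.
transitivity (\sum_(j < n.+1) (x j * z (n - j)%N + y j * z (n - j)%N) : R[i]).
  by apply: eq_bigr => j _; exact: mulrDl.
exact: big_split.
Qed.

Lemma cauchy_productZl (a : R[i]) x y :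
  cauchy_product (a *: x) y = a *: cauchy_product x y.
Proof.
apply/funext => n; rewrite /cauchy_product.
transitivity (\sum_(j < n.+1) a * (x j * y (n - j)%N) : R[i]).
  by apply: eq_bigr => j _; rewrite mulrA.
exact: esym (mulr_sumr _ _ _ _).
Qed.

Lemma cauchy_productBl x y z :
  cauchy_product (x - y) z = cauchy_product x z - cauchy_product y z.
Proof. by rewrite -(scaleN1r y) cauchy_productDl cauchy_productZl scaleN1r. Qed.

Lemma cauchy_product0l x : cauchy_product 0 x = 0.
Proof. by rewrite -[X in cauchy_product X](scale0r 0) cauchy_productZl scale0r. Qed.

Lemma cauchy_product1l x : cauchy_product (ebasis R 0) x = x.
Proof.
apply/funext => n; rewrite /cauchy_product big_ord_recl subn0 /ebasis eqxx mul1r.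
by rewrite big1 ?addr0// => i _; rewrite mul0r.
Qed.

Definition cauchy_power x k : omega R := iter k (cauchy_product x) (ebasis R 0).

Lemma cauchy_powerS x k :
  cauchy_power x k.+1 = cauchy_product x (cauchy_power x k).
Proof. by []. Qed.

Lemma cauchy_power_poly P k :
  cauchy_power (omega_of_poly P) k = omega_of_poly (P ^+ k).
Proof.
elim: k => [|k IH]; first by rewrite expr0 -(expr0 'X) omega_of_polyXn.
by rewrite cauchy_powerS IH exprS omega_of_polyM.
Qed.

(* The polynomial functional calculus, i.e. evaluation at x in the algebra of
   formal power series. *)
Definition cauchy_horner x P : omega R :=
  \sum_(i < size P) P`_i *: cauchy_power x i.

Lemma cauchy_horner_widen x P N : (size P <= N)%N ->
  cauchy_horner x P = \sum_(i < N) P`_i *: cauchy_power x i.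
Proof.
move=> PN; rewrite /cauchy_horner (big_ord_widen N (fun i => P`_i *: cauchy_power x i))//.
rewrite big_mkcond/=; apply: eq_bigr => i _; case: ltnP => // Pi.
by rewrite nth_default// scale0r.
Qed.

Lemma cauchy_hornerD x P Q :
  cauchy_horner x (P + Q) = cauchy_horner x P + cauchy_horner x Q.
Proof.
pose N := maxn (size P) (size Q).
rewrite !(@cauchy_horner_widen _ _ N) ?leq_maxl ?leq_maxr ?size_polyD//.
rewrite -big_split; apply: eq_bigr => i _.
by rewrite coefD scalerDl.
Qed.

Lemma cauchy_hornerZ x (a : R[i]) P :
  cauchy_horner x (a *: P) = a *: cauchy_horner x P.
Proof.
rewrite (@cauchy_horner_widen _ _ (size P)) ?size_scale_leq// scaler_sumr.
by apply: eq_bigr => i _; rewrite coefZ scalerA.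
Qed.

Lemma cauchy_horner0 x : cauchy_horner x 0 = 0.
Proof. by rewrite /cauchy_horner size_poly0 big_ord0. Qed.

Lemma cauchy_hornerX x P :
  cauchy_horner x (P * 'X) = cauchy_product x (cauchy_horner x P).
Proof.
have [->|P0] := eqVneq P 0.
  by rewrite mul0r cauchy_horner0 cauchy_productC cauchy_product0l.
rewrite /cauchy_horner size_mulX// big_ord_recl coefMX eqxx scale0r add0r.
apply: (big_ind2 (fun a b => a = cauchy_product x b)).
- by rewrite cauchy_productC cauchy_product0l.
- move=> _ a _ b -> ->.
  by rewrite !(cauchy_productC x) cauchy_productDl.
- move=> i _; rewrite coefMX/= [RHS]cauchy_productC cauchy_productZl.
  by rewrite [in RHS]cauchy_productC.
Qed.

(** Induction along the Horner scheme [P * 'X + c]: multiplication by ['X] becomes the Cauchy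
    product with [x], and constants become multiples of the unit [ebasis R 0]. *)
Lemma cauchy_hornerM x P Q :
  cauchy_horner x (P * Q) = cauchy_product (cauchy_horner x P) (cauchy_horner x Q).
Proof.
elim/poly_ind: P => [|P c IH].
  by rewrite mul0r cauchy_horner0 cauchy_product0l.
have Hc : cauchy_horner x c%:P = c *: ebasis R 0.
  rewrite (@cauchy_horner_widen _ _ 1) ?size_polyC ?leq_b1//.
  by rewrite big_ord1 coefC eqxx.
rewrite mulrDl !cauchy_hornerD mulrAC mul_polyC cauchy_hornerZ !cauchy_hornerX IH.
by rewrite cauchy_productDl cauchy_productA Hc cauchy_productZl cauchy_product1l.
Qed.

Lemma cauchy_hornerXn x n : cauchy_horner x 'X^n = cauchy_power x n.
Proof.
elim: n => [|n IH].
  rewrite (@cauchy_horner_widen _ _ 1) ?size_polyXn// big_ord1 coefXn eqxx.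
  by rewrite scale1r.
by rewrite exprSr cauchy_hornerX IH.
Qed.

End Powers.

(** * Baire category argument in the algebra *)

Section Baire.
Variables (R : realType) (X : frechet_seq_algebra R).
Implicit Types (x y u : omega R).

Definition locally_at u (P : set (omega R)) :=
  exists q, exists2 eps : R, 0 < eps &
    forall y, carrier X y -> seminorm X q (y - u) < eps -> P y.

Lemma locally_at_sub u (P Q : set (omega R)) :
  (forall y, carrier X y -> P y -> Q y) -> locally_at u P -> locally_at u Q.
Proof.
move=> PQ [q [eps eps0 Pu]]; exists q, eps => // y yX yu.
by apply: PQ => //; exact: Pu.
Qed.

Lemma locally_atI u (P Q : set (omega R)) : carrier X u ->
  locally_at u P -> locally_at u Q -> locally_at u (P `&` Q).
Proof.
move=> uX [q [e e0 Pu]] [r [d d0 Qu]].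
exists (maxn q r), (Num.min e d); first by rewrite lt_min e0 d0.
move=> y yX; rewrite lt_min => /andP[ye yd].
have yuX : carrier X (y - u) by exact: carrierB.
split; [apply: Pu => //|apply: Qu => //].
- by apply: le_lt_trans ye; apply: seminorm_nondecreasing => //; exact: leq_maxl.
- by apply: le_lt_trans yd; apply: seminorm_nondecreasing => //; exact: leq_maxr.
Qed.

Lemma locally_at_forall u n (P : nat -> set (omega R)) : carrier X u ->
  (forall i, (i < n)%N -> locally_at u (P i)) ->
  locally_at u [set y | forall i, (i < n)%N -> P i y].
Proof.
move=> uX; elim: n => [|n IH] Pu; first by exists 0, 1.
have := locally_atI uX (IH (fun i ni => Pu i (ltnW ni))) (Pu n (ltnSn n)).
apply: locally_at_sub => y _ [/= Py Pny] i; rewrite ltnS leq_eqVlt.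
by case/orP => [/eqP->//|]; exact: Py.
Qed.

(** The hypothesis says that every [P j] has dense interior. Nested closed balls are chosen inside
    the successive [P j]; their radii tend to 0 and their seminorm indices to infinity, so the
    centres form a Cauchy sequence whose limit lies in all the balls. *)
Lemma frechet_baire (P : nat -> set (omega R)) :
  (forall j x q (eps : R), carrier X x -> 0 < eps -> exists y,
     [/\ carrier X y, seminorm X q (y - x) < eps & locally_at y (P j)]) ->
  exists2 u, carrier X u & forall j, P j u.
Proof.
move=> Pdense.
(* A ball is coded by its centre, the index of the seminorm measuring it, and its radius. *)
pose ball (s : omega R * nat * R) :=
  [set y | carrier X y /\ seminorm X s.1.2 (y - s.1.1) <= s.2].
pose good (s : omega R * nat * R) := carrier X s.1.1 /\ 0 < s.2.
have step (js : nat * (omega R * nat * R)) : exists s', good js.2 ->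
    [/\ good s', s'.2 <= js.1.+1%:R^-1, (js.1 <= s'.1.2)%N &
        ball s' `<=` ball js.2 `&` P js.1].
  case: js => j [[x q] eps]; rewrite /good/=.
  have [[xX eps0]|nok] := pselect (carrier X x /\ 0 < eps); last first.
    by exists (0, 0%N, 0).
  have e20 : 0 < eps / 2 by rewrite divr_gt0.
  have [y [yX yx [r [d d0 Pd]]]] := Pdense j x q _ xX e20.
  (* Radius [eps / 2] keeps the new ball in the old one, [d / 2] puts the closed ball inside the
     open ball contained in [P j], and [j.+1%:R^-1] forces the radii to 0. *)
  exists (y, maxn j (maxn q r), Num.min (Num.min (eps / 2) (d / 2)) j.+1%:R^-1).
  move=> _; split=> /=.
  - by split=> //; rewrite !lt_min e20 divr_gt0// invr_gt0 ltr0n.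
  - by rewrite ge_min lexx orbT.
  - exact: leq_maxl.
  - move=> z [/= zX]; rewrite !le_min -andbA => /and3P[zy1 zy2 _].
    have zyX : carrier X (z - y) by exact: carrierB.
    have le1 : seminorm X q (z - y) <= eps / 2.
      apply: le_trans zy1; apply: seminorm_nondecreasing => //.
      by rewrite leq_max leq_maxl orbT.
    have le2 : seminorm X r (z - y) <= d / 2.
      apply: le_trans zy2; apply: seminorm_nondecreasing => //.
      by rewrite !leq_max leqnn !orbT.
    split; first split => //=.
    + apply: le_trans (seminorm_triangle q zX yX xX) _.
      by rewrite [leRHS]splitr lerD// ltW.
    + by apply: Pd => //; apply: le_lt_trans le2 _; rewrite gtr_pMr// invf_lt1// ltr1n.
have [f fP] := choice step.
pose s := fix s n := if n is n'.+1 then f (n', s n') else (0, 0%N, 1) : omega R * nat * R.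
have sgood n : good (s n).
  elim: n => [|n IH]; first by split=> //=; exact: carrier0.
  by have [] := fP (n, s n) IH.
have sP n := fP (n, s n) (sgood n).
have sball n k : (n <= k)%N -> ball (s k) `<=` ball (s n).
  elim: k => [|k IH]; first by rewrite leqn0 => /eqP->.
  rewrite leq_eqVlt => /orP[/eqP->//|/IH nk].
  by have [_ _ _ sk] := sP k; move=> y /sk[/nk].
have sctr n : ball (s n) (s n).1.1.
  have [xX e0] := sgood n; split=> //; rewrite subrr seminorm0; exact: ltW.
(* Stage [n] measures its ball by a seminorm of index at least [n.-1], which dominates seminorm
   [r]. *)
have sdist r n k : (r < n)%N -> (n <= k)%N ->
    seminorm X r ((s k).1.1 - (s n).1.1) <= n%:R^-1.
  case: n => // n; rewrite ltnS => rn nk.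
  have [kX kn] := sball _ _ nk _ (sctr k); have [nX _] := sctr n.+1.
  have [_ en qn _] := sP n.
  apply: le_trans (le_trans kn en); apply: seminorm_nondecreasing.
    exact: leq_trans qn.
  exact: carrierB.
have [u uX su] : exists2 u, carrier X u &
    cvg_seminorms (seminorm X) (fun n => (s n).1.1) u.
  apply: seminorm_complete => [n|q eps eps0]; first by have [] := sgood n.
  have [N _ NP] := near_infty_natSinv_lt (PosNum (divr_gt0 eps0 (ltr0n R 2))).
  exists (N + q).+1 => k l Nk Nl.
  have [cX _] := sgood (N + q).+1.
  have [kX _] := sgood k; have [lX _] := sgood l.
  apply: le_lt_trans (seminorm_triangle q kX cX lX) _.
  rewrite (splitr eps) (seminorm_distC _ cX lX).
  have h : ((N + q).+1%:R^-1 : R) < eps / 2 by apply: NP => /=; exact: leq_addr.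
  by apply: ltrD; apply: le_lt_trans h; apply: sdist; rewrite // ltnS leq_addl.
exists u => // j.
have [_ _ _ sj] := sP j; suff /sj[] : ball (s j.+1) u by [].
(* The closed ball contains the limit of the later centres: the inequality is proved up to an
   arbitrary [e]. *)
split=> //; apply/ler_addgt0Pl => e e0.
have [N _ NP] : \forall k \near \oo, seminorm X (s j.+1).1.2 ((s k).1.1 - u) < e.
  have /cvgr0Pnorm_lt/(_ _ e0) := su (s j.+1).1.2.
  by apply: filterS => k; apply: le_lt_trans; rewrite ler_norm.
set k := maxn N j.+1.
have [kX _] := sgood k; have [jX _] := sgood j.+1.
apply: le_trans (seminorm_triangle _ uX kX jX) _.
apply: lerD.
  by rewrite seminorm_distC//; apply/ltW/NP; rewrite /= leq_maxl.
have [_ //] := sball _ _ (leq_maxr N j.+1) _ (sctr k).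
Qed.

End Baire.

(** * Continuity of the iterates of the shift and of the powers *)

Section Continuity.
Variables (R : realType) (X : frechet_seq_algebra R) (w : nat -> R[i]).
Implicit Types (x y u v : omega R).

Lemma weighted_shiftB x y :
  weighted_shift w (x - y) = weighted_shift w x - weighted_shift w y.
Proof. by apply/funext => n; exact: mulrBr. Qed.

Lemma wprodS n : wprod w n.+1 = wprod w n * w n.+1.
Proof. by rewrite /wprod big_nat_recr. Qed.

Lemma wprod_neq0 n : (forall i, (0 < i)%N -> w i != 0) -> wprod w n != 0.
Proof.
move=> w0; elim: n => [|n IH]; first by rewrite /wprod big_geq// oner_neq0.
by rewrite wprodS mulf_neq0// w0.
Qed.

Lemma iter_weighted_shiftE p x n : (forall i, (0 < i)%N -> w i != 0) ->
  iter p (weighted_shift w) x n = wprod w (n + p) / wprod w n * x (n + p)%N.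
Proof.
move=> w0.
have W0 k : wprod w k != 0 by exact: wprod_neq0.
elim: p n => [|p IH] n; first by rewrite addn0 divff// mul1r.
rewrite iterS {1}/weighted_shift IH addSnnS.
rewrite (wprodS n).
rewrite mulrA; congr (_ * _).
by field; rewrite W0 w0.
Qed.

Lemma iter_weighted_shiftB p x y : iter p (weighted_shift w) (x - y) =
  iter p (weighted_shift w) x - iter p (weighted_shift w) y.
Proof. by elim: p => //= p ->; exact: weighted_shiftB. Qed.

Lemma weighted_shiftZD (a : R[i]) x y : weighted_shift w (a *: x + y) =
  a *: weighted_shift w x + weighted_shift w y.
Proof.
apply/funext => n; rewrite /weighted_shift !fctE mulrDr.
by congr (_ + _); rewrite /GRing.scale/= mulrCA.
Qed.

Lemma iter_weighted_shiftZD p (a : R[i]) x y :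
  iter p (weighted_shift w) (a *: x + y) =
  a *: iter p (weighted_shift w) x + iter p (weighted_shift w) y.
Proof. by elim: p => //= p ->; exact: weighted_shiftZD. Qed.

Lemma iter_weighted_shift0 p : iter p (weighted_shift w) 0 = 0.
Proof.
by rewrite -[X in iter _ _ X](subrr 0) iter_weighted_shiftB subrr.
Qed.

Lemma iter_weighted_shift_sum p (I : Type) (r : seq I) (a : I -> R[i])
    (F : I -> omega R) :
  iter p (weighted_shift w) (\sum_(i <- r) a i *: F i) =
  \sum_(i <- r) a i *: iter p (weighted_shift w) (F i).
Proof.
elim: r => [|i r IH]; first by rewrite !big_nil iter_weighted_shift0.
by rewrite !big_cons iter_weighted_shiftZD IH.
Qed.

Lemma carrier_power x k :
  carrier X (ebasis R 0) -> carrier X x -> carrier X (cauchy_power x k).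
Proof.
by move=> e0X xX; elim: k => //= k IH; exact: carrier_cauchy_product.
Qed.

Hypothesis hw : admissible X w.

Lemma carrier_iter_shift p x :
  carrier X x -> carrier X (iter p (weighted_shift w) x).
Proof. by case: hw => _ [TX _ _] xX; elim: p => //= p; exact: TX. Qed.

(** Continuity is given through open sets; pulling back a seminorm ball around 0 turns it into an
    estimate, which is then iterated. *)
Lemma iter_shift_continuous p q (eps : R) : 0 < eps ->
  exists r, exists2 d : R, 0 < d & forall y, carrier X y ->
    seminorm X r y < d -> seminorm X q (iter p (weighted_shift w) y) < eps.
Proof.
elim: p q eps => [|p IH] q eps eps0; first by exists q, eps.
have [_ [_ _ Tc]] := hw.
have Uo : open_in X [set y | carrier X y /\ seminorm X q y < eps].
  split=> [y []//|y [yX ye]]; exists q, (eps - seminorm X q y).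
    by rewrite subr_gt0.
  move=> z zX zy; split=> //; rewrite -(subrK y z).
  apply: le_lt_trans (seminormD _ _ _) _ => //; first exact: carrierB.
  by rewrite -ltrBrDr.
have [_ /(_ 0)[]] := Tc _ Uo.
  split; [exact: carrier0|].
  have := iter_weighted_shift0 1; rewrite /= => ->.
  by split; [exact: carrier0|rewrite seminorm0].
move=> r [d d0 Pd]; have [r' [d' d'0 Pd']] := IH r d d0.
exists r', d' => // y yX /(Pd' _ yX) yd.
have TyX := carrier_iter_shift p yX.
by have [_ []] := Pd _ TyX (etrans (congr1 (fun z => seminorm X r z < d) (subr0 _)) yd).
Qed.

Hypothesis e0X : carrier X (ebasis R 0).

(** Submultiplicativity lets one seminorm control both sides. The induction uses y^(k+1) - u^(k+1) =
    (y - u) y^k + (y^k - u^k) u. *)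
Lemma cauchy_power_continuous u k q (eps : R) : carrier X u -> 0 < eps ->
  exists2 d : R, 0 < d & forall y, carrier X y -> seminorm X q (y - u) < d ->
    seminorm X q (cauchy_power y k - cauchy_power u k) < eps.
Proof.
move=> uX; elim: k eps => [|k IH] eps eps0.
  by exists 1 => // y _ _; rewrite subrr seminorm0.
set V := cauchy_power u k in IH *.
set a := seminorm X q u; set b := seminorm X q V.
have a0 : 0 <= a by exact: seminorm_ge0.
have b0 : 0 <= b by apply/seminorm_ge0/carrier_power.
(* The bound 1 keeps the [k]-th power of [y] within [b + 1]; the other bound makes the second
   summand at most [eps / 2]. Adding 1 to [a] and [b] avoids division by zero. *)
have e10 : 0 < Num.min 1 (eps / 2 / (a + 1)).
  by rewrite lt_min ltr01 !divr_gt0// ltr_wpDl.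
have [d d0 Pd] := IH _ e10.
exists (Num.min d (eps / 2 / (b + 1))).
  by rewrite lt_min d0 !divr_gt0// ltr_wpDl.
move=> y yX; rewrite lt_min => /andP[/(Pd _ yX)]; rewrite lt_min.
move=> /andP[yd1 yd2] yd3.
set Y := cauchy_power y k in yd1 yd2 *.
have VX : carrier X V by exact: carrier_power.
have YX : carrier X Y by exact: carrier_power.
have -> : cauchy_power y k.+1 - cauchy_power u k.+1 =
    cauchy_product (y - u) Y + cauchy_product (Y - V) u.
  rewrite !cauchy_powerS !cauchy_productBl -/Y -/V.
  by rewrite (cauchy_productC Y u) (cauchy_productC V u) addrA subrK.
have yuX : carrier X (y - u) by exact: carrierB.
have YVX : carrier X (Y - V) by exact: carrierB.
apply: le_lt_trans (seminormD _ _ _) _; [exact: carrier_cauchy_product..|].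
have YB : seminorm X q Y <= b + 1.
  rewrite -(subrK V Y); apply: le_trans (seminormD _ _ _) _ => //.
  by rewrite addrC lerD2l ltW.
rewrite (splitr eps); apply: ltr_leD.
  apply: le_lt_trans (seminorm_cauchy_product _ _ _) _ => //.
  apply: (@le_lt_trans _ _ (seminorm X q (y - u) * (b + 1))).
    by apply: ler_wpM2l => //; exact: seminorm_ge0.
  by rewrite -ltr_pdivlMr// ltr_wpDl.
apply: le_trans (seminorm_cauchy_product _ _ _) _ => //.
apply: (@le_trans _ _ (seminorm X q (Y - V) * (a + 1))).
  by apply: ler_wpM2l; [exact: seminorm_ge0|rewrite lerDl].
by rewrite -ler_pdivlMr ?ltr_wpDl// ltW.
Qed.

Lemma iter_shift_power_continuous p k u q (eps : R) : carrier X u -> 0 < eps ->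
  locally_at X u [set y | seminorm X q (iter p (weighted_shift w) (cauchy_power y k)
    - iter p (weighted_shift w) (cauchy_power u k)) < eps].
Proof.
move=> uX eps0.
have [r [d d0 Pd]] := iter_shift_continuous p q eps0.
have [e e0 Pe] := cauchy_power_continuous k r uX d0.
exists r, e => // y yX ye; rewrite /= -iter_weighted_shiftB; apply: Pd.
  by apply: carrierB; exact: carrier_power.
exact: Pe.
Qed.

(** One integer [q] fixes both the seminorm and the precision, which keeps the set of requirements
    countable. Exponents 0 and 1 are left out because the algebra has no constant or linear
    terms. *)
Definition power_hits m q v p : set (omega R) := [set y |
  seminorm X q (iter p (weighted_shift w) (cauchy_power y m) - v) < q.+1%:R^-1 /\
  forall k, (k < m)%N -> (1 < k)%N ->
    seminorm X q (iter p (weighted_shift w) (cauchy_power y k)) < q.+1%:R^-1].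

(** Finitely many strict inequalities between continuous quantities define an open condition; the
    slack of each gives the admissible perturbation. *)
Lemma power_hits_locally m q v p u : carrier X u -> carrier X v ->
  power_hits m q v p u -> locally_at X u (power_hits m q v p).
Proof.
move=> uX vX [um uk].
have itX k y : carrier X y -> carrier X (iter p (weighted_shift w) (cauchy_power y k)).
  by move=> yX; apply/carrier_iter_shift/carrier_power.
have near_lt k x : carrier X x ->
    seminorm X q (iter p (weighted_shift w) (cauchy_power u k) - x) < q.+1%:R^-1 ->
    locally_at X u [set y | seminorm X q
      (iter p (weighted_shift w) (cauchy_power y k) - x) < q.+1%:R^-1].
  move=> xX ux; rewrite -subr_gt0 in ux.
  apply: locally_at_sub (iter_shift_power_continuous p k q uX ux) => y yX /=.
  rewrite ltrBrDr => yu; apply: le_lt_trans yu.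
  by apply: seminorm_triangle; rewrite //; exact: itX.
apply: (locally_atI uX); first exact: near_lt.
apply: (@locally_at_forall _ _ _ m (fun k => [set y | (1 < k)%N -> seminorm X q
  (iter p (weighted_shift w) (cauchy_power y k)) < q.+1%:R^-1])) => // k km.
have [k1|k1] := ltnP 1 k; last by exists 0%N, 1.
have := near_lt k 0 (carrier0 X); rewrite subr0 => /(_ (uk _ km k1)).
by apply: locally_at_sub => y yX /=; rewrite subr0.
Qed.

End Continuity.

(** * Unconditional convergence and bounded multipliers *)

Section UnconditionalConvergence.
Variables (R : realType) (X : frechet_seq_algebra R) (v : nat -> omega R).
Hypothesis vX : forall n, carrier X (v n).

Lemma cvg_in_cauchy (u : nat -> omega R) x q (eps : R) : cvg_in X u x -> 0 < eps ->
  exists N, forall k l, (N <= k)%N -> (N <= l)%N -> seminorm X q (u k - u l) < eps.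
Proof.
move=> [uX xX ux] eps0.
have e20 : 0 < eps / 2 by rewrite divr_gt0.
have /cvgr0Pnorm_lt/(_ _ e20)[N _ NP] := ux q.
exists N => k l Nk Nl; apply: le_lt_trans (seminorm_triangle q (uX k) xX (uX l)) _.
rewrite (splitr eps) (seminorm_distC _ xX (uX l)).
by apply: ltrD; [have := NP _ Nk|have := NP _ Nl];
  apply: le_lt_trans; rewrite /= ler_norm.
Qed.

(* Otherwise there are pairwise disjoint finite blocks carrying large sums, and
   enumerating each block contiguously gives a divergent rearrangement. *)
Lemma unconditional_subset_tails q (eps : R) :
  unconditionally_convergent X v -> 0 < eps ->
  exists K, forall F : seq nat, uniq F -> {in F, forall n, (K <= n)%N} ->
    seminorm X q (\sum_(n <- F) v n) < eps.
Proof.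
move=> vuc eps0; apply: contrapT => /forallNP noK.
have /choice[F FP] K : exists F : seq nat, [/\ uniq F,
    {in F, forall n, (K <= n)%N} & ~ seminorm X q (\sum_(n <- F) v n) < eps].
  have /existsNP[F /not_implyP[Fu /not_implyP[FK Fe]]] := noK K.
  by exists F.
(* [L i] lists an initial segment of the integers. The next stage appends the bad block beyond
   [size (L i)], then the integers below [top] that are still missing, so that an initial segment is
   obtained again. *)
pose top (L : seq nat) := (size L + \max_(x <- F (size L)) x).+1.
pose rest (L : seq nat) :=
  [seq x <- iota (size L) (top L - size L) | x \notin F (size L)].
pose L := fix L i := if i is i'.+1 then L i' ++ F (size (L i')) ++ rest (L i')
                     else [::].
have Lperm i : perm_eq (L i) (iota 0 (size (L i))).
  elim: i => // i IH /=; set l := L i in IH *.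
  have [Fu FK _] := FP (size l).
  suff pm : perm_eq (l ++ F (size l) ++ rest l) (iota 0 (top l)).
    by rewrite (perm_size pm) size_iota.
  apply: uniq_perm; rewrite ?iota_uniq//.
    rewrite cat_uniq cat_uniq Fu filter_uniq ?iota_uniq// (perm_uniq IH) iota_uniq.
    rewrite /= andbT; apply/andP; split; apply/hasPn => x.
      rewrite (perm_mem IH) mem_iota add0n -leqNgt mem_cat => /orP[/FK//|].
      by rewrite mem_filter mem_iota => /andP[_ /andP[]].
    by rewrite mem_filter => /andP[].
  move=> x; rewrite !mem_cat (perm_mem IH) mem_filter !mem_iota !add0n.
  rewrite subnKC; last by rewrite /top -addnS leq_addr.
  have [xl|lx] := ltnP x (size l).
    by rewrite /= /top (leq_trans xl)// -addnS leq_addr.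
  rewrite /=; have [xF|//] := boolP (x \in F (size l)).
  by rewrite /= /top ltnS (leq_trans _ (leq_addl _ _))// leq_bigmax_seq.
have Lsize i : (i <= size (L i))%N.
  elim: i => // i IH; have [Fu FK _] := FP (size (L i)).
  suff : (size (L i) < size (L i.+1))%N by exact: leq_ltn_trans.
  suff : size (L i) \in L i.+1.
    by rewrite (perm_mem (Lperm i.+1)) mem_iota add0n => /andP[].
  rewrite /= !mem_cat mem_filter mem_iota leqnn subnKC /top.
    by rewrite ltnS leq_addr !andbT; case: (_ \in F _); rewrite ?orbT.
  by rewrite -addnS leq_addr.
have Lcat i j : (i <= j)%N -> exists l, L j = L i ++ l.
  elim: j => [|j IH]; first by rewrite leqn0 => /eqP->; exists [::]; rewrite cats0.
  rewrite leq_eqVlt => /orP[/eqP->|/IH[l /= ->]]; first by exists [::]; rewrite cats0.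
  by rewrite -catA; eexists.
have Lpre i j n : (i <= j)%N -> (n < size (L i))%N -> nth 0%N (L j) n = nth 0%N (L i) n.
  by move=> /Lcat[l ->] ni; rewrite nth_cat ni.
(* The limit of the lists [L i]; as [L n.+1] has more than [n] entries, the default 0 is never
   read. *)
pose s n := nth 0%N (L n.+1) n.
have sE j n : (n < size (L j))%N -> s n = nth 0%N (L j) n.
  move=> nj; rewrite /s; have [jn|nj1] := leqP j n.+1; first exact: Lpre.
  by rewrite (@Lpre n.+1 j)// ?Lsize// ltnW.
have Luniq i : uniq (L i) by rewrite (perm_uniq (Lperm i)) iota_uniq.
have Lmem i x : (x \in L i) = (x < size (L i))%N.
  by rewrite (perm_mem (Lperm i)) mem_iota.
have sbij : bijective s.
  exists (fun x => index x (L x.+1)) => [n|x].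
    pose j := maxn n.+1 (s n).+1.
    have nj : (n < size (L j))%N by apply: leq_trans (Lsize j); exact: leq_maxl.
    have [l Ll] : exists l, L j = L (s n).+1 ++ l by exact: Lcat (leq_maxr _ _).
    have snL : s n \in L (s n).+1 by rewrite Lmem.
    have -> : index (s n) (L (s n).+1) = index (s n) (L j).
      by rewrite Ll [RHS]index_cat snL.
    by rewrite (sE j n nj) index_uniq.
  have xL : x \in L x.+1 by rewrite Lmem.
  by rewrite (sE x.+1) ?index_mem// nth_index.
have [x xP] := vuc s sbij.
have [N NP] := cvg_in_cauchy q xP eps0.
have [Fu FK Fe] := FP (size (L N)); apply: Fe.
set f := F _ in Fu FK *.
have partial l : (forall k, (k < size l)%N -> s k = nth 0%N l k) ->
    \sum_(0 <= k < size l) v (s k) = \sum_(x <- l) v x.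
  move=> sl; rewrite [RHS](big_nth 0%N).
  by apply: eq_big_nat => k /andP[_ kl]; rewrite sl.
(* The block [f] directly follows [L N], so two late partial sums of the rearrangement differ
   exactly by the sum over [f]. *)
have := NP (size (L N ++ f)) (size (L N)).
rewrite !partial.
- rewrite big_cat/= addrAC subrr add0r; apply; last exact: Lsize.
  by rewrite size_cat (leq_trans (Lsize N))// leq_addr.
- by move=> k kN; exact: sE.
- move=> k kN; rewrite (sE N.+1)/= catA.
    by rewrite nth_cat kN.
  by rewrite size_cat (leq_trans kN)// leq_addr.
Qed.

(** A sum with coefficients in [0, 1] is a convex combination of subset sums. Each index [x] of [F]
    is split off with weight [a x] for keeping it and [1 - a x] for dropping it; [G] collects the
    kept indices. *)
Lemma seminorm_convex_combination q (eps : R) (F G : seq nat) (a : nat -> R) :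
  (forall n, 0 <= a n <= 1) -> uniq (F ++ G) ->
  (forall H, uniq H -> {subset H <= F ++ G} ->
    seminorm X q (\sum_(n <- H) v n) <= eps) ->
  seminorm X q (\sum_(n <- F) (a n)%:C%C *: v n + \sum_(n <- G) v n) <= eps.
Proof.
move=> a01; elim: F G => [|x F IH] G.
  by rewrite big_nil add0r => uG; apply.
move=> uFG Hs; have /andP[a0 a1] := a01 x; rewrite big_cons.
set S := \sum_(n <- F) _; set V := \sum_(n <- G) _.
have SX : carrier X S by apply: carrier_sum => n _; exact: carrierZ.
have VX : carrier X V by apply: carrier_sum => n _.
have e1 : seminorm X q (S + (v x + V)) <= eps.
  have := IH (x :: G); rewrite big_cons; apply.
    by rewrite (uniq_catCA F [:: x] G).
  move=> H uH HFG; apply: Hs => // y /HFG.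
  by rewrite /= inE !mem_cat inE orbCA.
have e2 : seminorm X q (S + V) <= eps.
  apply: IH => [|H uH HFG]; first by move: uFG => /= /andP[].
  by apply: Hs => // y /HFG yFG; rewrite /= inE yFG orbT.
have ca : normc ((1 - a x)%:C)%C = 1 - a x.
  by rewrite /normc/= expr0n addr0 sqrtr_sqr ger0_norm ?subr_ge0.
have ca' : normc ((a x)%:C)%C = a x.
  by rewrite /normc/= expr0n addr0 sqrtr_sqr ger0_norm.
have -> : (a x)%:C%C *: v x + S + V =
    (a x)%:C%C *: (S + (v x + V)) + (1 - a x)%:C%C *: (S + V).
  have -> : S + (v x + V) = S + V + v x by rewrite -addrA (addrC V).
  rewrite rmorphB rmorph1 (scalerBl 1 _ (S + V)) scale1r (scalerDr _ (S + V)).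
  rewrite [RHS]addrC addrA subrK addrC -addrA.
  by rewrite addrCA addrA.
apply: le_trans (seminormD _ _ _) _.
- by apply: carrierZ; do 2 apply: carrierD => //.
- by apply: carrierZ; apply: carrierD.
rewrite !seminormZ ?ca ?ca'; [|by do ?apply: carrierD..].
have -> : eps = a x * eps + (1 - a x) * eps by ring.
by apply: lerD; apply: ler_wpM2l; rewrite // subr_ge0.
Qed.

Lemma normc_real (a : R) : normc (a%:C)%C = `|a|.
Proof. by rewrite /normc/= expr0n addr0 sqrtr_sqr. Qed.

Lemma normc_Re (z : R[i]) : `|complex.Re z| <= normc z.
Proof.
case: z => a b /=; rewrite -sqrtr_sqr ler_sqrt ?lerDl ?sqr_ge0//.
by rewrite addr_ge0 ?sqr_ge0.
Qed.

Lemma normc_Im (z : R[i]) : `|complex.Im z| <= normc z.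
Proof.
case: z => a b /=; rewrite -sqrtr_sqr ler_sqrt ?lerDr ?sqr_ge0//.
by rewrite addr_ge0 ?sqr_ge0.
Qed.

(** The multipliers split into real and imaginary parts, and these into positive and negative parts.
    After division by [M] each of the four has coefficients in [0, 1], whence the share
    [eps / M / 4]. *)
Lemma unconditional_bounded_multiplier_tails q (eps M : R) :
  unconditionally_convergent X v -> 0 < eps -> 0 < M ->
  exists K, forall (F : seq nat) (z : nat -> R[i]),
    uniq F -> {in F, forall n, (K <= n)%N} -> (forall n, normc (z n) <= M) ->
    seminorm X q (\sum_(n <- F) z n *: v n) <= eps.
Proof.
move=> vuc eps0 M0.
have e40 : 0 < eps / M / 4 by rewrite !divr_gt0.
have [K KP] := unconditional_subset_tails q vuc e40.
exists K => F z uF FK zM.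
have small (a : nat -> R) : (forall n, 0 <= a n <= 1) ->
    seminorm X q (\sum_(n <- F) (a n)%:C%C *: v n) <= eps / M / 4.
  move=> a01; have := @seminorm_convex_combination q (eps / M / 4) F [::] a a01.
  rewrite cats0 big_nil addr0; apply=> // H uH HF.
  by apply/ltW/KP => // n /HF /FK.
have sX (a : nat -> R) : carrier X (\sum_(n <- F) (a n)%:C%C *: v n).
  by apply: carrier_sum => n _; exact: carrierZ.
have signed (b : nat -> R) : (forall n, `|b n| <= M) ->
    seminorm X q (\sum_(n <- F) (b n)%:C%C *: v n) <= eps / 2.
  move=> bM.
  have H : \sum_(n <- F) (b n)%:C%C *: v n =
      M%:C%C *: (\sum_(n <- F) (Num.max 0 (b n / M))%:C%C *: v n -
                 \sum_(n <- F) (Num.max 0 (- (b n / M)))%:C%C *: v n).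
    rewrite -sumrB scaler_sumr; apply: eq_bigr => n _.
    rewrite -scalerBl scalerA -rmorphB -rmorphM; congr (_%:C%C *: _).
    have -> : Num.max 0 (b n / M) - Num.max 0 (- (b n / M)) = b n / M.
      case: (leP 0 (b n / M)) => h; case: (leP 0 (- (b n / M))) => h'; lra.
    by rewrite mulrC divfK// gt_eqF.
  rewrite H seminormZ; last by apply: carrierB; exact: sX.
  rewrite normc_real gtr0_norm// mulrC -ler_pdivlMr//.
  have bM1 n : `|b n / M| <= 1.
    by rewrite normrM normfV (gtr0_norm M0) ler_pdivrMr// mul1r.
  apply: le_trans (seminormD _ _ _) _; [exact: sX|exact/carrierN/sX|].
  rewrite seminormN; last exact: sX.
  have -> : eps / 2 / M = eps / M / 4 + eps / M / 4 by field; rewrite gt_eqF.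
  by apply: lerD; apply: small => n; have := bM1 n; rewrite le_max lexx/= ge_max ler01/=;
    rewrite ler_norml => /andP[]; lra.
have -> : \sum_(n <- F) z n *: v n = \sum_(n <- F) (complex.Re (z n))%:C%C *: v n +
    'i%C *: \sum_(n <- F) (complex.Im (z n))%:C%C *: v n.
  rewrite scaler_sumr -big_split; apply: eq_bigr => n _ /=.
  by rewrite scalerA -scalerDl -complexE.
apply: le_trans (seminormD _ _ _) _; [exact: sX|exact/carrierZ/sX|].
rewrite seminormZ; last exact: sX.
have -> : normc 'i%C = 1 :> R.
  by rewrite /normc/= expr0n add0r expr1n sqrtr1.
rewrite mul1r [leRHS]splitr; apply: lerD; apply: signed => n.
  by apply: le_trans (zM n); exact: normc_Re.
by apply: le_trans (zM n); exact: normc_Im.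
Qed.

End UnconditionalConvergence.

(** * The F-norm against single seminorms *)

Section FNorm.
Variables (R : realType) (X : frechet_seq_algebra R).
Implicit Types (x : omega R).

Let Fterm x := fun q => 2^-1 ^+ q.+1 * Num.min 1 (seminorm X q x).

Lemma Fnorm_series x : carrier X x ->
  (forall n, series (Fterm x) n <= Fnorm X x) /\ Fnorm X x <= 1.
Proof.
move=> xX.
have half0 : (0 : R) < 2^-1 by rewrite invr_gt0.
have t0 q : 0 <= Fterm x q.
  by rewrite mulr_ge0 ?exprn_ge0 ?(ltW half0)// le_min ler01 seminorm_ge0.
have mono : {homo series (Fterm x) : n m / (n <= m)%N >-> n <= m}.
  by move=> n m nm; exact: (nondecreasing_series (fun k _ _ => t0 k)).
have le1 n : series (Fterm x) n <= 1.
  (* Comparison with the geometric series; boundedness makes the limit defining [Fnorm] a genuine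
     one. *)
  suff H : series (Fterm x) n <= 1 - 2^-1 ^+ n.
    by apply: le_trans H _; rewrite gerBl exprn_ge0// (ltW half0).
  rewrite /series/=; elim: n => [|n IH]; first by rewrite big_geq// expr0 subrr.
  rewrite big_nat_recr//=.
  have h : Fterm x n <= 2^-1 ^+ n.+1.
    by rewrite ler_piMr ?exprn_ge0 ?(ltW half0)// ge_min lexx.
  apply: le_trans (lerD IH h) _.
  have -> : (2^-1 : R) ^+ n = 2 * 2^-1 ^+ n.+1 by rewrite exprS mulrA divff ?mul1r.
  by rewrite le_eqVlt; apply/orP; left; apply/eqP; ring.
have cv : cvgn (series (Fterm x)).
  by apply: nondecreasing_is_cvgn => //; exists 1 => _ [n _ <-].
split; first exact: nondecreasing_cvgn_le.
by apply: limr_le => //; exact: nearW.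
Qed.

(** The F-norm dominates its term of index [q], and [d <= 1] rules out that the minimum in that term
    is 1. *)
Lemma Fnorm_lt_seminorm x q (d : R) : carrier X x -> d <= 1 ->
  Fnorm X x < 2^-1 ^+ q.+1 * d -> seminorm X q x < d.
Proof.
move=> xX d1 xd; have [/(_ q.+1) + _] := Fnorm_series xX.
have p0 : (0 : R) < 2^-1 ^+ q.+1 by rewrite exprn_gt0// invr_gt0.
move=> /le_lt_trans/(_ xd); rewrite /series/= big_nat_recr//= => H.
have : Fterm x q < 2^-1 ^+ q.+1 * d.
  apply: le_lt_trans H; rewrite lerDr sumr_ge0// => i _.
  by rewrite mulr_ge0 ?exprn_ge0 ?invr_ge0// le_min ler01 seminorm_ge0.
by rewrite /Fterm ltr_pM2l// gt_min ltNge d1.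
Qed.

End FNorm.

(** * The tail sums of assumption (b) *)

Section TailSums.
Variables (R : realType) (X : frechet_seq_algebra R) (w : nat -> R[i]).
Hypothesis eX : forall n, carrier X (ebasis R n).

Lemma carrier_poly (P : {poly R[i]}) : carrier X (omega_of_poly P).
Proof.
rewrite (omega_of_poly_sum (leqnn _)); apply: carrier_sum => n _.
exact: carrierZ.
Qed.

Lemma carrier_tail_sum m c s b z : carrier X (tail_sum w m c s b z).
Proof. by apply: carrier_sum => n _; exact: carrierZ. Qed.

Lemma tail_sum_small m (c : R) (b : nat -> R[i]) q (eps : R) :
  (fun s : nat => sup [set Fnorm X (tail_sum w m c s (b s) z)
                      | z in c00 R `&` ball_linfty R]) @ \oo --> (0 : R) ->
  0 < eps -> exists S, forall s z, (S <= s)%N -> c00 R z -> ball_linfty R z ->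
    seminorm X q (tail_sum w m c s (b s) z) < eps.
Proof.
move=> sup0 eps0; pose d := Num.min 1 eps.
have d0 : 0 < 2^-1 ^+ q.+1 * d.
  by rewrite mulr_gt0 ?exprn_gt0 ?invr_gt0// lt_min ltr01.
have /cvgr0Pnorm_lt/(_ _ d0)[S _ SP] := sup0.
exists S => s z Ss zc zb; apply: (@lt_le_trans _ _ d); last by rewrite ge_min lexx orbT.
apply: Fnorm_lt_seminorm; [exact: carrier_tail_sum|by rewrite ge_min lexx|].
have := SP s Ss; apply: le_lt_trans; apply: le_trans (ler_norm _).
(* The real supremum bounds its set only if the set is bounded above; here the F-norm is at most
   1. *)
apply: ub_le_sup; last by exists z.
by exists 1 => _ [y _ <-]; have [] := Fnorm_series (carrier_tail_sum m c s (b s) y).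
Qed.

(** As [Z] has no coefficients below [c * s], the cut-off loses nothing, and the sum over an
    infinite set reduces to the degrees of [Z]. *)
Lemma tail_sum_poly m (c : R) s b (Z : {poly R[i]}) :
  (forall n, n%:R < c * s%:R -> Z`_n = 0) ->
  tail_sum w m c s b (omega_of_poly Z) = omega_of_poly
    (\poly_(n < size Z) (Z`_n * b / wprod w (m.-1 * s + n))).
Proof.
move=> Zc; rewrite [RHS](@omega_of_poly_sum _ _ (size Z)) ?size_poly//.
pose r := [seq n <- index_iota 0 (size Z) | c * s%:R <= n%:R].
rewrite /tail_sum (fsbigE r).
- rewrite big_filter_cond big_nat_cond [RHS]big_nat_cond big_mkcond [RHS]big_mkcond.
  apply: eq_bigr => n _; rewrite coef_poly; case: (ltnP n) => //= nZ.
  case: ifPn => //; have [nc _|cn] := ltP (n%:R : R) (c * s%:R).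
    by rewrite (Zc _ nc) !mul0r scale0r.
  by rewrite mem_set//.
- by rewrite filter_uniq// iota_uniq.
- by move=> n /=; rewrite mem_filter => /andP[].
- move=> n /= cn; rewrite mem_filter cn mem_index_iota/= -leqNgt => Zn.
  by rewrite /omega_of_poly nth_default// !mul0r scale0r.
Qed.

Lemma c00_poly (Z : {poly R[i]}) : c00 R (omega_of_poly Z).
Proof.
apply: (@sub_finite_set _ _ `I_(size Z)) => // n /=.
by apply: contraTT; rewrite -leqNgt negbK => nZ; rewrite /omega_of_poly nth_default.
Qed.

End TailSums.

(** * High-degree coefficients of powers *)

Section PolynomialPowers.
Variable F : fieldType.
Implicit Types (E : {poly F}).

Lemma coef_exp_eq0 E k d j : (size E <= d.+1)%N -> (k * d < j)%N -> (E ^+ k)`_j = 0.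
Proof.
move=> Ed kj; rewrite nth_default//; apply: leq_trans (size_poly_exp_leq _ _) _.
apply: leq_ltn_trans kj; rewrite mulnC leq_mul2l -subn1 leq_subLR add1n Ed.
by rewrite orbT.
Qed.

(* In the range of j considered, every product of two or more factors E has too
   small a degree to contribute. *)
Lemma coef_exp_add_monomial E (e : F) m s g j :
  (size E <= g)%N -> (0 < g <= s)%N -> (m * s + 2 * g <= j)%N -> (m.+1 * s <= j)%N ->
  ((E + e *: 'X^s) ^+ m.+2)`_j =
    m.+2%:R * e ^+ m.+1 * E`_(j - m.+1 * s) + (j == m.+2 * s)%N%:R * e ^+ m.+2.
Proof.
move=> Eg /andP[g0 gs] j1 j2; rewrite addrC exprDn coef_sum 2!big_ord_recl /=.
(* The binomial term with [i + 2] factors [E] has degree at most (m-i)s + (i+2)(g-1), which is at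
   most ms + 2(g-1) since g <= s, hence below [j]. *)
rewrite big1 => [|i _]; rewrite ?addr0; last first.
  rewrite coefMn exprZn -scalerAl coefZ -exprM coefXnM /bump/= !add1n.
  case: ltnP => ij; first by rewrite mulr0 mul0rn.
  rewrite (@coef_exp_eq0 _ _ g.-1) ?mulr0 ?mul0rn ?prednK//.
  have : (i < m.+1)%N by case: i {ij}.
  rewrite !subSS => im.
  have im' : (m * s = ((m - i) + i) * s)%N by rewrite subnK// -ltnS.
  case: g g0 gs j1 Eg => // g _ gs j1 _.
  have igs : (i * g <= i * s)%N by rewrite leq_mul2l ltnW// orbT.
  move: j1; rewrite im' mulnDl (mulnC (m - i)%N) /= => j1.
  by rewrite ltn_subRL; lia.
rewrite addrC; congr (_ + _).
  rewrite coefMn subSS subn0 bin1 expr1 exprZn -scalerAl coefZ -exprM coefXnM.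
  rewrite mulnC ltnNge j2/= -[LHS]mulr_natl.
  by rewrite mulrA.
rewrite subn0 expr0 mulr1 bin0 mulr1n exprZn coefZ -exprM coefXn mulrC.
by rewrite (mulnC s).
Qed.

End PolynomialPowers.

(** * Counting frequencies *)

Section Frequency.
Variable R : realType.

Definition frequency (A : set nat) N : R :=
  (\sum_(1 <= n < N.+1) \1_A n) / N%:R.

Lemma frequency_mono (A B : set nat) N :
  (forall n, (n <= N)%N -> A n -> B n) -> frequency A N <= frequency B N.
Proof.
move=> AB; rewrite /frequency ler_wpM2r ?invr_ge0// big_nat [leRHS]big_nat.
apply: ler_sum => n /andP[_ nN]; rewrite !indicE ler_nat.
have [nA|//] := boolP (n \in A).
by rewrite mem_set//; apply: AB => //; exact: set_mem.
Qed.

Lemma frequency_ge (A : set nat) N k (f : nat -> nat) : injective f ->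
  (forall i, (i < k)%N -> (0 < f i <= N)%N /\ A (f i)) ->
  k%:R / N%:R <= frequency A N.
Proof.
move=> finj fA; rewrite /frequency ler_wpM2r ?invr_ge0//.
pose s := map f (iota 0 k).
have sk : (size s <= size [seq n <- index_iota 1 N.+1 | n \in s])%N.
  apply: uniq_leq_size; first by rewrite map_inj_uniq ?iota_uniq.
  move=> _ /mapP[i + ->]; rewrite mem_iota/= add0n => ik.
  rewrite mem_filter mem_index_iota ltnS (fA _ ik).1 andbT.
  by rewrite map_f ?mem_iota.
rewrite size_map size_iota in sk.
apply: (@le_trans _ _ (\sum_(1 <= n < N.+1 | n \in s) 1)).
  by rewrite -big_filter big_const_seq count_predT iter_addr_0 ler_nat.
rewrite [leLHS]big_mkcond; apply: ler_sum => n _; case: ifP => // /mapP[i + ->].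
by rewrite mem_iota/= add0n => /fA[_ ?]; rewrite indicE mem_set.
Qed.

End Frequency.

(** The degrees [G0], [g] and [s] are spaced by [kt], so the block [G0, g) has room for [tau]
    periods of length [K], starting at a multiple of [K]. Moreover G0 / s = 1 - 1/(h+2), which can
    be brought above any c < 1 by the choice of [h]. *)
Lemma block_sizes h K tau : (0 < K)%N -> (0 < tau)%N ->
  exists kt G0 a0 g s : nat, [/\ kt = (K * tau)%N, (a0 * K)%N = G0, (kt <= G0)%N,
    (tau <= kt)%N & [/\ g = (G0 + kt)%N, s = (g + kt)%N & s = (2 * h.+2 * kt)%N]].
Proof.
move=> K0 tau0; pose kt := (K * tau)%N.
exists kt, (2 * h.+1 * kt)%N, (2 * h.+1 * tau)%N, (2 * h.+1 * kt + kt)%N.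
exists (2 * h.+2 * kt)%N; split=> //; rewrite ?leq_pmull//; last split=> //.
- by rewrite /kt -mulnA (mulnC tau).
- by rewrite !mulnS !mulnDl; lia.
Qed.

(** * Construction of the perturbations *)

Section Density.
Variables (R : realType) (X : frechet_seq_algebra R) (w : nat -> R[i]).

Lemma normc_ge0 (z : R[i]) : 0 <= normc z.
Proof. by case: z => a b; exact: sqrtr_ge0. Qed.

Lemma poly_dense x q (eps : R) : schauder_basis X (@ebasis R) -> carrier X x ->
  0 < eps -> exists P, seminorm X q (omega_of_poly P - x) < eps.
Proof.
move=> [_ basis] xX eps0; have [a [[_ _ /(_ q) ax] _]] := basis x xX.
have /cvgr0Pnorm_lt/(_ _ eps0)[N _ NP] := ax.
exists (\poly_(n < N) a n); have := NP N (leqnn N); apply: le_lt_trans.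
rewrite (@omega_of_poly_sum _ _ N) ?size_poly//.
rewrite (@eq_big_nat _ _ _ 0%N N (fun n => (\poly_(n < N) a n)`_n *: ebasis R n)
  (fun n => a n *: ebasis R n)); last by move=> n /andP[_ nN]; rewrite coef_poly nN.
exact: ler_norm.
Qed.

Hypothesis eX : forall n, carrier X (ebasis R n).
Hypothesis hw : admissible X w.

Let w0 i : (0 < i)%N -> w i != 0.
Proof. by case: hw => + _; apply. Qed.

Let W0 n : wprod w n != 0.
Proof. exact: wprod_neq0. Qed.

Variable fpow : nat -> nat -> R[i].
Hypothesis hfpow : forall m sigma : nat, (2 <= m)%N -> (1 <= sigma)%N ->
  is_fracpow m.-1 m (wprod w (m * sigma)) (fpow m sigma).
Hypothesis ha : unconditionally_convergent X
  (fun n => (wprod w n.+1)^-1 *: ebasis R n.+1).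
Hypothesis hb : forall m : nat, (2 <= m)%N ->
  exists2 c : R, 0 < c < 1 &
    (fun sigma : nat =>
      sup [set Fnorm X (tail_sum w m c sigma (fpow m sigma) z)
          | z in c00 R `&` ball_linfty R]) @ \oo --> (0 : R).
Hypothesis hS : schauder_basis X (@ebasis R).

Let T := weighted_shift w.

(** The order of the quantifiers is what the Baire argument needs: [delta] is fixed before the
    vector [x], the closeness [eta] and the bound [N0]. *)
Lemma power_hits_dense m q (y : {poly R[i]}) : (2 <= m)%N ->
  exists2 delta : R, 0 < delta & forall x q' (eta : R) N0, carrier X x -> 0 < eta ->
    exists P : {poly R[i]}, seminorm X q' (omega_of_poly P - x) < eta /\
      exists N, [/\ (N0 <= N)%N, (0 < N)%N &
        delta <= frequency R [set p | power_hits X w m q (omega_of_poly y) p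
                                        (omega_of_poly P)] N].
Proof.
case: m => [|[|m]] // _; set m2 := m.+2.
have [c /andP[c0 c1] csup] := @hb m2 isT.
have [h0 hc] : exists h0 : nat, c + h0.+2%:R^-1 <= 1.
  have [h0 h0P] := ltr_add_invr c1.
  exists h0; apply: le_trans (ltW h0P); rewrite lerD2l lef_pV2 ?posrE// ler_nat.
  by [].
pose M : R := 1 + \sum_(l < size y) normc (y`_l * wprod w l).
have M1 : 1 <= M.
  by rewrite lerDl sumr_ge0// => l _; exact: normc_ge0.
have M0 : 0 < M by exact: lt_le_trans M1.
have yM l : normc (y`_l * wprod w l) <= M.
  have [ly|yl] := ltnP l (size y); last by rewrite nth_default// mul0r normc0 ltW.
  rewrite /M (bigD1 (Ordinal ly))//= addrCA lerDl addr_ge0//.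
  apply: sumr_ge0 => k _. exact: normc_ge0.
have q20 : 0 < (q.+1%:R^-1 / 2 : R) by rewrite divr_gt0.
have MM0 : 0 < M + 1 by rewrite ltr_wpDr.
have vX n : carrier X ((wprod w n.+1)^-1 *: ebasis R n.+1) by exact: carrierZ.
(* The multipliers will be the [zeta] below: at most [M] from the block and 1 from the monomial. *)
have [K0 K0P] := unconditional_bounded_multiplier_tails vX q ha q20 MM0.
(* One period is long enough to contain [y], and everything beyond it is a small tail. *)
pose K' := maxn K0 (size y); pose K := K'.+1.
(* This is [tau / (m2 * sigma)], in which the yet unchosen [tau] cancels. *)
pose delta : R := (m2 * (2 * h0.+2 * K))%:R^-1.
exists delta; first by rewrite invr_gt0 ltr0n !muln_gt0.
move=> x q' eta N0 xX eta0.
have e20 : 0 < eta / 2 by rewrite divr_gt0.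
have [Xp Xpx] := poly_dense q' hS xX e20.
have e40 : 0 < eta / (4 * M) by rewrite divr_gt0// mulr_gt0.
have [S SP] := tail_sum_small eX q' csup e40.
have [tau [tau0 N0tau Stau Xptau]] : exists tau, [/\ (0 < tau)%N, (N0 <= tau)%N,
    (S <= tau)%N & (size Xp <= tau)%N].
  exists (maxn N0 (maxn S (size Xp))).+1.
  by rewrite ltn0Sn !leqW ?leq_maxl// !leq_max leqnn !orbT.
have [kt [G0 [a0 [g [sigma [ktE a0K ktG0 tauK [gE sE sigmaE]]]]]]] :=
  block_sizes h0 (ltn0Sn K') tau0.
have G00 : (0 < G0)%N by exact: leq_trans tau0 (leq_trans tauK ktG0).
have taus : (tau <= sigma)%N by rewrite sE (leq_trans tauK)// leq_addl.
have Ssigma : (S <= sigma)%N by exact: leq_trans taus.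
have XpG0 : (size Xp <= G0)%N by exact: leq_trans Xptau (leq_trans tauK ktG0).
have csigma : c * sigma%:R <= G0%:R.
  have -> : G0%:R = sigma%:R - 2 * kt%:R :> R.
    by rewrite sE gE !natrD; ring.
  have hinv : (h0.+2%:R : R) * h0.+2%:R^-1 = 1 by rewrite divff.
  have -> : 2 * kt%:R = h0.+2%:R^-1 * sigma%:R :> R.
    rewrite sigmaE !natrM; transitivity ((h0.+2%:R * h0.+2%:R^-1) * (2 * kt%:R) : R).
      by rewrite hinv mul1r.
    by move: (h0.+2%:R : R) => H; ring.
  have s0 : 0 <= sigma%:R :> R by [].
  by rewrite -[X in _ <= X - _]mul1r -mulrBl ler_wpM2r// lerBrDr.
have sigma1 : (0 < sigma)%N by exact: leq_trans taus.
have [rho rhoW fpowE] := hfpow (isT : (2 <= m2)%N) sigma1.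
set b := fpow m2 sigma in fpowE SP.
have rho0 : rho != 0.
  apply: contra_neq (W0 (m2 * sigma)) => r0; by rewrite -rhoW r0 expr0n.
(* Since [rho ^+ m2] is W_(m2 sigma) and [b] is [rho ^+ m.+1], the same root gives both [e ^+ m2] =
   1/W_(m2 sigma) and [e ^+ m.+1 * b = 1]. *)
pose e := rho^-1.
(* The coefficients of [y], weighted by W_l and repeated with period [K] over the block [G0, g). *)
pose Z := \poly_(n < g) (if (G0 <= n)%N then y`_(n %% K) * wprod w (n %% K) else 0).
have Zlt n : (n < G0)%N -> Z`_n = 0.
  by move=> nG; rewrite coef_poly (leqNgt G0) nG if_same.
have ZM n : normc Z`_n <= M.
  rewrite coef_poly; case: ifP => _; last by rewrite normc0 ltW.
  by case: ifP => _; [exact: yM|rewrite normc0 ltW].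
have cZ (Q : {poly R[i]}) : (forall n, (n < G0)%N -> Q`_n = 0) ->
    forall n, n%:R < c * sigma%:R -> Q`_n = 0.
  by move=> Q0 n nc; apply: Q0; rewrite -(ltr_nat R); exact: lt_le_trans csigma.
(* Chosen so that the cross term [m2%:R * e ^+ m.+1 * D] has coefficient Z_n / W_((m+1) sigma + n)
   in degree [n]. *)
pose D := m2%:R^-1 *: \poly_(n < size Z) (Z`_n * b / wprod w (m.+1 * sigma + n)).
have DE n : D`_n = m2%:R^-1 * (Z`_n * b / wprod w (m.+1 * sigma + n)).
  rewrite coefZ coef_poly; case: ltnP => // Zn.
  by rewrite (nth_default _ Zn) !mul0r.
have Dsmall : seminorm X q' (omega_of_poly D) < eta / 4.
  (* Normalised to lie in the unit ball, so that assumption (b) applies. *)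
  pose Z1 := (M%:C)%C^-1 *: Z.
  have MC0 : (M%:C)%C != 0 :> R[i] by apply/eqP => -[] /eqP; rewrite gt_eqF.
  have -> : omega_of_poly D = (m2%:R^-1 * (M%:C)%C : R[i]) *:
      tail_sum w m2 c sigma b (omega_of_poly Z1).
    rewrite tail_sum_poly; last first.
      by apply: cZ => n nG; rewrite coefZ (Zlt n nG) mulr0.
    rewrite -omega_of_polyZ; congr omega_of_poly; apply/polyP => n.
    rewrite DE coefZ coef_poly; case: ltnP => nZ1.
      by rewrite coefZ; field; rewrite W0 MC0 pnatr_eq0.
    have := nth_default 0 nZ1; rewrite coefZ => /eqP.
    by rewrite mulf_eq0 invr_eq0 (negbTE MC0)/= => /eqP ->; rewrite !mul0r !mulr0.
  rewrite seminormZ; last exact: carrier_tail_sum.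
  have zb : ball_linfty R (omega_of_poly Z1).
    move=> n; rewrite /omega_of_poly coefZ normcM normcV normc_real (gtr0_norm M0).
    by rewrite mulrC ler_pdivrMr// mul1r.
  have small := SP sigma _ Ssigma (c00_poly Z1) zb.
  have nM : normc (m2%:R^-1 * (M%:C)%C : R[i]) <= M.
    rewrite normcM normcV normc_real (gtr0_norm M0) ler_piMl ?(ltW M0)//.
    have -> : (m2%:R : R[i]) = ((m2%:R : R)%:C)%C by rewrite rmorph_nat.
    by rewrite normc_real ger0_norm// invf_le1 ?ltr0n// ler1n.
  apply: (@le_lt_trans _ _
    (M * seminorm X q' (tail_sum w m2 c sigma b (omega_of_poly Z1)))).
    by rewrite ler_wpM2r//; apply/seminorm_ge0/carrier_tail_sum.
  have -> : eta / 4 = M * (eta / (4 * M)) by field; rewrite gt_eqF.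
  by rewrite ltr_pM2l.
have esmall : seminorm X q' (omega_of_poly (e *: 'X^sigma)) < eta / 4.
  (* The monomial is itself a tail sum: in degree [sigma] the quotient is rho^(m+1) / rho^(m+2) =
     [e]. *)
  have -> : omega_of_poly (e *: 'X^sigma) =
      tail_sum w m2 c sigma b (omega_of_poly 'X^sigma).
    rewrite tail_sum_poly; last first.
      apply: cZ => n nG; rewrite coefXn ltn_eqF//; apply: leq_trans nG _.
      by rewrite sE gE -addnA leq_addr.
    congr omega_of_poly; apply/polyP => n.
    rewrite coefZ coef_poly size_polyXn coefXn ltnS.
    have [->|ns] := eqVneq n sigma; last by rewrite mulr0 !mul0r if_same.
    rewrite leqnn mulr1 mul1r fpowE -mulSnr -rhoW /e.
    transitivity (rho ^+ m.+1 / (rho * rho ^+ m.+1)); last by rewrite -exprS.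
    by rewrite invfM mulrCA divff ?mulr1// expf_neq0.
  apply: (@lt_le_trans _ _ (eta / (4 * M))).
    apply: SP => //; first exact: c00_poly.
    move=> n; rewrite /omega_of_poly coefXn.
    by case: (_ == _); rewrite ?normc0 ?normc1.
  by rewrite ler_pM2l// lef_pV2 ?posrE ?mulr_gt0// ler_peMr.
pose E := Xp + D; pose U := E + e *: 'X^sigma.
have sizeE : (size E <= g)%N.
  rewrite (leq_trans (size_polyD _ _))// geq_max (leq_trans XpG0) ?gE ?leq_addr//=.
  apply: leq_trans (size_scale_leq _ _) _; apply: leq_trans (size_poly _ _) _.
  by rewrite -gE; exact: size_poly.
have sizeU : (size U <= sigma.+1)%N.
  apply: leq_trans (size_polyD _ _) _; rewrite geq_max; apply/andP; split.
    by apply: leq_trans sizeE _; rewrite sE leqW// leq_addr.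
  by apply: leq_trans (size_scale_leq _ _) _; rewrite size_polyXn.
exists U; split.
  have -> : omega_of_poly U - x = (omega_of_poly Xp - x) + omega_of_poly D +
      omega_of_poly (e *: 'X^sigma).
    rewrite /U /E !omega_of_polyD -!addrA; congr (_ + _).
    by rewrite [RHS]addrCA; congr (_ + _); rewrite addrC.
  have XX : carrier X (omega_of_poly Xp - x).
    by apply: carrierB => //; exact: carrier_poly.
  have DX : carrier X (omega_of_poly D) by exact: carrier_poly.
  have eXX : carrier X (omega_of_poly (e *: 'X^sigma)) by exact: carrier_poly.
  apply: le_lt_trans (seminormD _ (carrierD XX DX) eXX) _.
  by have := seminormD q' XX DX; lra.
exists (m2 * sigma)%N; split.
- by apply: leq_trans N0tau (leq_trans taus _); rewrite leq_pmull.
- by rewrite muln_gt0.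
have -> : delta = tau%:R / (m2 * sigma)%:R.
  have tau1 : tau%:R != 0 :> R by rewrite pnatr_eq0 -lt0n.
  have -> : (m2 * sigma = m2 * (2 * h0.+2 * K) * tau)%N by rewrite sigmaE ktE !mulnA.
  by rewrite natrM invfM mulrCA divff// mulr1.
(* The good times are the [tau] shifts that move the start of a period of the block to degree 0. *)
apply: (@frequency_ge _ _ _ _ (fun i => (m.+1 * sigma + (a0 + i) * K)%N)).
  by move=> i j /addnI /eqP; rewrite eqn_pmul2r// eqn_add2l => /eqP.
move=> i itau.
have iK : (i * K + K <= kt)%N by rewrite ktE -mulSnr mulnC leq_mul2l itau orbT.
have kK : ((a0 + i) * K = G0 + i * K)%N by rewrite mulnDl a0K.
set kk := ((a0 + i) * K)%N in kK *.
set p := (m.+1 * sigma + kk)%N.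
have m2s : (m2 * sigma = m.+1 * sigma + sigma)%N by rewrite /m2 mulSnr.
split.
  by rewrite /p m2s kK; clear -G00 iK sE gE; lia.
have itE k r : iter p T (omega_of_poly (U ^+ k)) r =
    wprod w (r + p) / wprod w r * (U ^+ k)`_(r + p).
  by rewrite iter_weighted_shiftE.
split; last first.
  move=> k km k1; rewrite cauchy_power_poly.
  (* The lower powers have degree at most [m.+1 * sigma], which is less than [p]: the shift
     annihilates them. *)
  have -> : iter p T (omega_of_poly (U ^+ k)) = 0.
    apply/funext => r; rewrite itE (@coef_exp_eq0 _ _ _ sigma) ?mulr0//.
    have kms : (k * sigma <= m.+1 * sigma)%N by rewrite leq_mul2r -(ltnS k) km orbT.
    apply: (leq_ltn_trans kms); rewrite /p addnCA -[ltnLHS]addn0 ltn_add2l.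
    by rewrite kK addnCA ltn_addr.
  by rewrite seminorm0.
(* What remains of the [m2]-th power after the shift, up to the factor 1/W_r: the shifted block and
   one unit coming from the monomial. *)
pose zeta r := Z`_(r + kk) + (r + p == m2 * sigma)%N%:R.
have itm r : iter p T (omega_of_poly (U ^+ m2)) r = zeta r / wprod w r.
  rewrite itE (@coef_exp_add_monomial _ _ _ _ _ g); first last.
  - by rewrite /p addnCA leq_addr.
  - by rewrite /p mulSn kK sE gE; clear; lia.
  - by rewrite sE leq_addr gE addn_gt0 G00.
  - exact: sizeE.
  have -> : (r + p - m.+1 * sigma = r + kk)%N by rewrite /p addnCA addKn.
  rewrite coefD DE.
  have -> : Xp`_(r + kk) = 0.
    by rewrite nth_default// (leq_trans XpG0)// kK addnCA leq_addr.
  have -> : (m.+1 * sigma + (r + kk) = r + p)%N by rewrite /p addnCA.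
  have eb : e ^+ m.+1 * b = 1 by rewrite fpowE -exprMn mulVf// expr1n.
  have Zeb : Z`_(r + kk) = Z`_(r + kk) * (e ^+ m.+1 * b) by rewrite eb mulr1.
  have m20 : (m2%:R : R[i]) != 0 by rewrite pnatr_eq0.
  have eW : (r + p == m2 * sigma)%N%:R * e ^+ m2 * wprod w (r + p) =
      (r + p == m2 * sigma)%N%:R.
    have [->|_] := eqVneq (r + p)%N (m2 * sigma)%N; last by rewrite !mul0r.
    by rewrite mul1r -rhoW -exprMn mulVf// expr1n.
  rewrite add0r /zeta [RHS]mulrDl -[in RHS]eW [in RHS]Zeb -/m2.
  move: ((r + p == m2 * sigma)%N%:R * e ^+ m2 : R[i]) (m2%:R : R[i]) m20 => B n2 n20.
  field.
  by rewrite !W0 n20.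
(* Within the first period the match with [y] is exact: [kk] is a multiple of [K], the period lies
   inside the block, and the monomial sits in a higher degree. *)
have itlt r : (r < K)%N -> iter p T (omega_of_poly (U ^+ m2)) r = y`_r.
  move=> rK; rewrite itm /zeta.
  have rg : (r + kk < g)%N by rewrite kK gE; clear -rK iK; lia.
  rewrite ltn_eqF; last by rewrite m2s /p sE; clear -rg; lia.
  rewrite addr0 coef_poly rg kK ifT; last by rewrite addnCA leq_addr.
  have -> : ((r + (G0 + i * K)) %% K = r)%N.
    by rewrite -kK /kk addnC modnMDl modn_small.
  by rewrite mulfK.
have itgt r : (sigma < r)%N -> iter p T (omega_of_poly (U ^+ m2)) r = 0.
  move=> rs; rewrite itm /zeta nth_default; last first.
    apply: leq_trans (size_poly _ _) _.
    by rewrite (leq_trans _ (leq_addr _ _))// (leq_trans _ (ltnW rs))// sE leq_addr.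
  rewrite gtn_eqF ?addr0 ?mul0r// m2s /p addnCA ltn_add2l.
  by rewrite (leq_trans rs)// leq_addr.
have zetaM r : normc (zeta r) <= M + 1.
  apply: le_trans (le_normcD _ _) _; apply: lerD => //.
  by case: (_ == _); rewrite ?normc0 ?normc1.
rewrite cauchy_power_poly.
(* The error lives in degrees K, ..., sigma; the index is lowered by one because the series of (a)
   starts at degree 1. *)
have -> : iter p T (omega_of_poly (U ^+ m2)) - omega_of_poly y =
    \sum_(n <- index_iota K' sigma) zeta n.+1 *: ((wprod w n.+1)^-1 *: ebasis R n.+1).
  pose Q := \poly_(r < sigma.+1) (if (K <= r)%N then zeta r / wprod w r else 0).
  have Ks : (K <= sigma.+1)%N.
    by rewrite leqW// sE (leq_trans _ (leq_addl _ _))// (leq_trans (leq_addl _ _) iK).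
  have -> : iter p T (omega_of_poly (U ^+ m2)) - omega_of_poly y = omega_of_poly Q.
    apply/funext => r; rewrite !fctE [RHS]coef_poly ltnS.
    have [rK|Kr] := ltnP r K; first by rewrite itlt// if_same subrr.
    rewrite [X in _ - X]nth_default ?subr0; last first.
      by apply: leq_trans Kr; rewrite leqW// leq_maxr.
    by case: leqP => rs; [exact: itm|exact: itgt].
  rewrite (@omega_of_poly_sum _ _ sigma.+1) ?size_poly// (@big_cat_nat _ _ _ K)//=.
  rewrite big_nat big1 ?add0r; last first.
    move=> n /andP[_ nK]; rewrite coef_poly (leqNgt K) nK if_same.
    exact: scale0r.
  rewrite big_add1/=; apply: eq_big_nat => n /andP[Kn ns].
  by rewrite coef_poly !ltnS ns Kn scalerA.
apply: (@le_lt_trans _ _ (q.+1%:R^-1 / 2)).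
  apply: K0P; first exact: iota_uniq.
    by move=> n; rewrite mem_index_iota => /andP[+ _]; apply: leq_trans; exact: leq_maxl.
  by move=> n; exact: zetaM.
by rewrite gtr_pMr// invf_lt1// ltr1n.
Qed.

End Density.

(** * Countably many targets and upper density *)

Section Targets.
Variables (R : realType) (X : frechet_seq_algebra R).
Hypothesis eX : forall n, carrier X (ebasis R n).

(** The codes form a countable type, so that the targets can be enumerated by [unpickle]. *)
Definition rational_poly (t : seq (rat * rat)) : {poly R[i]} :=
  Poly [seq ((ratr r.1 : R) +i* (ratr r.2 : R))%C | r <- t].

Lemma rational_complex_dense (z : R[i]) (eps : R) : 0 < eps ->
  exists r : rat * rat, normc (((ratr r.1 : R) +i* (ratr r.2 : R))%C - z) < eps.
Proof.
move=> eps0; case: z => a b.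
have near (x : R) : exists r : rat, `|ratr r - x| < eps / 2.
  have [|r] := @rat_in_itvoo _ (x - eps / 2) (x + eps / 2); first lra.
  by rewrite in_itv/= => /andP[h1 h2]; exists r; rewrite ltr_norml; lra.
have [r rP] := near a; have [s sP] := near b.
exists (r, s); set z := _ - _.
rewrite (complexE z); apply: le_lt_trans (le_normcD _ _) _.
rewrite normcM !normc_real.
have -> : normc 'i%C = 1 :> R by rewrite /normc/= expr0n add0r expr1n sqrtr1.
by rewrite mul1r /z/= (splitr eps) ltrD.
Qed.

(** Horner induction: the error at [P * 'X + c%:P] is [ebasis R 1] times the previous error plus a
    multiple of [ebasis R 0]. *)
Lemma rational_poly_dense q P (eps : R) : 0 < eps -> exists t,
  seminorm X q (omega_of_poly (rational_poly t) - omega_of_poly P) < eps.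
Proof.
elim/poly_ind: P eps => [|P c IH] eps eps0.
  by exists [::]; rewrite subrr seminorm0.
have n0 k : 0 <= seminorm X q (ebasis R k) by exact: seminorm_ge0.
have e1 : 0 < eps / 2 / (seminorm X q (ebasis R 1) + 1).
  by rewrite !divr_gt0// ltr_wpDl.
have e2 : 0 < eps / 2 / (seminorm X q (ebasis R 0) + 1).
  by rewrite !divr_gt0// ltr_wpDl.
have [t tP] := IH _ e1; have [r rP] := rational_complex_dense c e2.
exists (r :: t); rewrite -omega_of_polyB; rewrite -omega_of_polyB in tP.
set z := (_ +i* _)%C in rP.
have -> : rational_poly (r :: t) - (P * 'X + c%:P) =
    'X^1 * (rational_poly t - P) + (z - c) *: 'X^0.
  rewrite /rational_poly /= cons_poly_def -/z expr1 expr0 alg_polyC polyCB.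
  by rewrite opprD addrACA -mulrBl (mulrC 'X).
rewrite omega_of_polyD omega_of_polyM omega_of_polyZ !omega_of_polyXn.
have dX : carrier X (omega_of_poly (rational_poly t - P)) by exact: carrier_poly.
apply: le_lt_trans (seminormD _ _ _) _; [exact: carrier_cauchy_product|exact: carrierZ|].
rewrite seminormZ//.
have h1 : seminorm X q (cauchy_product (ebasis R 1) (omega_of_poly (rational_poly t - P)))
    <= eps / 2.
  apply: le_trans (seminorm_cauchy_product _ _ _) _ => //.
  rewrite mulrC; apply: le_trans (_ : _ <= seminorm X q (omega_of_poly
    (rational_poly t - P)) * (seminorm X q (ebasis R 1) + 1)) _.
    by apply: ler_wpM2l; [exact: seminorm_ge0|rewrite lerDl].
  by rewrite -ler_pdivlMr ?ltr_wpDl// ltW.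
have h2 : normc (z - c) * seminorm X q (ebasis R 0) < eps / 2.
  apply: le_lt_trans (_ : _ <= normc (z - c) * (seminorm X q (ebasis R 0) + 1)) _.
    by apply: ler_wpM2l; [exact: normc_ge0|rewrite lerDl].
  by rewrite -ltr_pdivlMr ?ltr_wpDl.
by rewrite (splitr eps) ler_ltD.
Qed.

(** The limit superior is the limit of the suprema over the tails, each of which is at least
    [delta]. *)
Lemma upper_density_ge (A : set nat) (delta : R) :
  (forall N0, exists2 N, (N0 <= N)%N & delta <= frequency R A N) ->
  (delta%:E <= upper_density R A)%E.
Proof.
move=> Afreq; rewrite /upper_density limn_esup_lim.
apply: lime_ge; first exact: is_cvg_esups.
apply: nearW => n; have [N nN AN] := Afreq n.
apply: le_trans (_ : _ <= (frequency R A N)%:E)%E _; first by rewrite lee_fin.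
by apply: ereal_sup_ubound; exists N.
Qed.

End Targets.

(** * The generic vector and its algebra *)

Theorem theorem5p7 (R : realType) (X : frechet_seq_algebra R) (w : nat -> R[i])
    (fpow : nat -> nat -> R[i])
    (hX : regular_algebra X) (hw : admissible X w)
    (hfpow : forall m sigma : nat, (2 <= m)%N -> (1 <= sigma)%N ->
       is_fracpow m.-1 m (wprod w (m * sigma)) (fpow m sigma))
    (ha : unconditionally_convergent X
       (fun n => (wprod w n.+1)^-1 *: ebasis R n.+1))
    (hb : forall m : nat, (2 <= m)%N ->
       exists2 c : R, 0 < c < 1 &
         (fun sigma : nat =>
            sup [set Fnorm X (tail_sum w m c sigma (fpow m sigma) z)
                | z in c00 R `&` ball_linfty R]) @ \oo --> (0 : R)) :
  exists A : set (omega R),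
    upper_frequently_hypercyclic_algebra X (weighted_shift w) A.
Proof.
have [_ hS _] := hX; have eX := hS.1.
pose tgt t : omega R := omega_of_poly (rational_poly R t).
have tgtX t : carrier X (tgt t) by exact: carrier_poly.
pose hits m q t y := [set p | power_hits X w m.+2 q (tgt t) p y].
have dense (i : nat * nat * seq (rat * rat)) := power_hits_dense
  eX hw hfpow ha hb hS i.1.2 (rational_poly R i.2) (isT : (2 <= i.1.1.+2)%N).
pose delta i := s2val (cid2 (dense i)).
have delta0 i : 0 < delta i := s2valP (cid2 (dense i)).
have deltaP i := s2valP' (cid2 (dense i)).
pose frequent i N0 := [set y | exists N, [/\ (N0 <= N)%N, (0 < N)%N &
  delta i <= frequency R (hits i.1.1 i.1.2 i.2 y) N]].
(* The index [i] holds the exponent minus 2, the precision and the target; integers coding nothing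
   impose no condition. *)
pose requirement j := if unpickle j is Some (i, N0) then frequent i N0 else setT.
have [u uX uP] : exists2 u, carrier X u & forall j, requirement j u.
  apply: (@frechet_baire _ X) => j x q eps xX eps0; rewrite /requirement.
  case: (unpickle j) => [[i N0]|]; last first.
    by exists x; split=> //; [rewrite subrr seminorm0|exists 0%N, 1].
  have [P [Px [N [N0N Npos Pfreq]]]] := deltaP i x q eps N0 xX eps0.
  have PX : carrier X (omega_of_poly P) by exact: carrier_poly.
  exists (omega_of_poly P); split=> //.
  pose stays p := [set y | hits i.1.1 i.1.2 i.2 (omega_of_poly P) p ->
                           hits i.1.1 i.1.2 i.2 y p].
  (* Only the times up to [N] enter the frequency, so finitely many open conditions preserve it near
     [P]. *)
  have : locally_at X (omega_of_poly P)
      [set y | forall p, (p < N.+1)%N -> stays p y].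
    apply: locally_at_forall => // p _.
    have [Pp|nPp] := pselect (hits i.1.1 i.1.2 i.2 (omega_of_poly P) p); last first.
      by exists 0%N, 1 => // y _ _ /nPp.
    have := power_hits_locally hw (eX 0%N) PX (tgtX i.2) Pp.
    by apply: locally_at_sub => y _ yp _.
  apply: locally_at_sub => y _ yN; exists N; split=> //.
  by apply: le_trans Pfreq _; apply: frequency_mono => p pN; exact: yN.
have ufreq i N0 : frequent i N0 u.
  by have := uP (pickle (i, N0)); rewrite /requirement pickleK.
have powX k : carrier X (cauchy_power u k) by exact: carrier_power.
have hornerX P : carrier X (cauchy_horner u P).
  by apply: carrier_sum => k _; exact: carrierZ.
pose T := weighted_shift w.
have TX p z : carrier X z -> carrier X (iter p T z) by exact: carrier_iter_shift.
(* The factor ['X^2] removes the constant and linear terms. *)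
exists [set z | exists P, z = cauchy_horner u (P * 'X^2)]; split.
- split=> [_ [P ->]//||_ _ [P ->] [Q ->]].
  + split=> [|_ _ [P ->] [Q ->]|a _ [P ->]].
    * by exists 0; rewrite mul0r cauchy_horner0.
    * by exists (P + Q); rewrite mulrDl cauchy_hornerD.
    * by exists (a *: P); rewrite -scalerAl cauchy_hornerZ.
  + by exists (P * 'X^2 * Q); rewrite -cauchy_hornerM mulrA.
(* Otherwise the square of [u] would be 0, although its orbit comes close to a target near
   [ebasis R 0]. *)
- move=> A0.
  have u20 : cauchy_power u 2 = 0.
    have : [set z | exists P, z = cauchy_horner u (P * 'X^2)] (cauchy_power u 2).
      by exists 1; rewrite mul1r cauchy_hornerXn.
    by rewrite A0.
  have [q eq] : exists q, 0 < seminorm X q (ebasis R 0).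
    apply: contrapT => /forallNP noq.
    have e00 : ebasis R 0 = 0.
      apply: (@seminorm_separating _ X) => // q; apply/eqP; rewrite eq_le.
      by rewrite seminorm_ge0// andbT leNgt; apply/negP/noq.
    by have /eqP := congr1 (fun f => f 0%N) e00; rewrite /ebasis eqxx oner_eq0.
  have e20 : 0 < seminorm X q (ebasis R 0) / 2 by rewrite divr_gt0.
  have [q1 _ q1P] := near_infty_natSinv_lt (PosNum e20).
  pose q' := maxn q q1.
  have q'e : q'.+1%:R^-1 < seminorm X q (ebasis R 0) / 2.
    by apply: q1P; rewrite /= leq_maxr.
  have [t] := rational_poly_dense eX q' 'X^0 e20.
  rewrite omega_of_polyXn -/(tgt t) => te.
  have [N [_ _ Nfreq]] := ufreq (0%N, q', t) 0%N.
  have [p [pt _]] : exists p, hits 0%N q' t u p.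
    apply: contrapT => /forallNP nohit.
    have := lt_le_trans (delta0 (0%N, q', t)) Nfreq; rewrite ltNge => /negP; apply.
    apply: le_trans (_ : _ <= frequency R set0 N) _.
      by apply: frequency_mono => p _ /nohit.
    by rewrite /frequency big1 ?mul0r// => n _; rewrite indicE in_set0.
  rewrite u20 iter_weighted_shift0 sub0r seminormN// in pt.
  have le_qq' : seminorm X q (ebasis R 0) <= seminorm X q' (ebasis R 0).
    by apply: seminorm_nondecreasing => //; exact: leq_maxl.
  suff : seminorm X q (ebasis R 0) < seminorm X q (ebasis R 0) by rewrite ltxx.
  apply: le_lt_trans le_qq' _.
  have {1}-> : ebasis R 0 = tgt t + (ebasis R 0 - tgt t) by rewrite addrC subrK.
  apply: le_lt_trans (seminormD _ _ _) _ => //; first exact: carrierB.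
  rewrite (seminorm_distC _ (eX 0%N) (tgtX t)) [ltRHS]splitr.
  by apply: ltrD => //; exact: lt_trans q'e.
move=> x [P xP] x0; split; first by rewrite xP.
move=> U [UX Uo] [x1 Ux1].
have P0 : P != 0.
  by apply: contra_notN x0 => /eqP P0; rewrite xP P0 mul0r cauchy_horner0.
have x1X := UX _ Ux1.
have [q0 [eps eps0 epsU]] := Uo _ Ux1.
(* The leading exponent of [Q] is [m.+2], and [m] is its index among the requirements. *)
pose m := (size P).-1; pose Q := P * 'X^2.
have sQ : size Q = m.+3.
  by rewrite /Q size_mulXn// /m -(prednK (_ : 0 < size P)%N) ?size_poly_gt0.
pose a := Q`_m.+2.
have a0 : a != 0.
  have := lead_coef_eq0 Q; rewrite /lead_coef sQ /= -/a => ->.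
  by rewrite mulf_neq0// -size_poly_gt0 size_polyXn.
pose B := \sum_(k < m.+2) normc Q`_k.
have B0 : 0 <= B by apply: sumr_ge0 => k _; exact: normc_ge0.
(* Total error in units of the precision: [B] for the lower powers, [normc a] for hitting the target
   and again for replacing [a^-1 *: x1] by it; the 1 keeps [C] positive. *)
pose C := B + 2 * normc a + 1.
have C0 : 0 < C.
  by rewrite /C ltr_wpDl// addr_ge0// mulr_ge0// normc_ge0.
have epsC : 0 < eps / C by exact: divr_gt0.
have [q1 _ q1P] := near_infty_natSinv_lt (PosNum epsC).
pose q := maxn q0 q1.
have qC : q.+1%:R^-1 * C < eps.
  by rewrite -ltr_pdivlMr//; apply: q1P; rewrite /= leq_maxr.
have q20 : 0 < (q.+1%:R^-1 : R) / 2 by rewrite divr_gt0.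
have ax1X : carrier X (a^-1 *: x1) by exact: carrierZ.
have [V Vx1] := poly_dense q hS ax1X q20.
have [t tV] := rational_poly_dense eX q V q20.
have VX : carrier X (omega_of_poly V) by exact: carrier_poly.
have tx1 : seminorm X q (tgt t - a^-1 *: x1) < q.+1%:R^-1.
  apply: le_lt_trans (seminorm_triangle q (tgtX t) VX ax1X) _.
  by rewrite [ltRHS]splitr ltrD.
(* The leading power is sent near [a^-1 *: x1] and the lower ones near 0, so [x] is sent near
   [x1]. *)
have hitU p : hits m q t u p -> U (iter p T x).
  move=> [pm pk]; apply: epsU; first by apply: TX; rewrite xP.
  have -> : iter p T x - x1 = \sum_(k < m.+2) Q`_k *: iter p T (cauchy_power u k) +
      (a *: (iter p T (cauchy_power u m.+2) - tgt t) + a *: (tgt t - a^-1 *: x1)).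
    rewrite xP /cauchy_horner -/Q sQ iter_weighted_shift_sum big_ord_recr/= -/a.
    rewrite -addrA; congr (_ + _); rewrite -scalerDr addrA subrK scalerBr.
    by rewrite scalerA divff// scale1r.
  have termX k : carrier X (Q`_k *: iter p T (cauchy_power u k)).
    by apply/carrierZ/TX.
  have sumX : carrier X (\sum_(k < m.+2) Q`_k *: iter p T (cauchy_power u k)).
    by apply: carrier_sum => k _; exact: termX.
  have hX1 : carrier X (iter p T (cauchy_power u m.+2) - tgt t).
    by apply: carrierB => //; exact: TX.
  have hX2 : carrier X (tgt t - a^-1 *: x1) by exact: carrierB.
  set z := _ + _; have zX : carrier X z.
    by apply: carrierD => //; apply: carrierD; exact: carrierZ.
  apply: le_lt_trans (_ : _ <= seminorm X q z) _.
    by apply: seminorm_nondecreasing => //; exact: leq_maxl.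
  apply: le_lt_trans qC.
  apply: le_trans (seminormD _ _ _) _ => //; first by apply: carrierD; exact: carrierZ.
  have sum_le : seminorm X q (\sum_(k < m.+2) Q`_k *: iter p T (cauchy_power u k)) <=
      q.+1%:R^-1 * B.
    apply: le_trans (@seminorm_sum _ X q 'I_m.+2 (index_enum _) xpredT
      (fun k => Q`_k *: iter p T (cauchy_power u k)) (fun k _ => termX k)) _.
    rewrite mulr_sumr; apply: ler_sum => k _.
    rewrite seminormZ; last exact: TX.
    have [k1|k1] := ltnP 1 k.
      by rewrite mulrC ler_wpM2r ?normc_ge0// ltW// pk.
    have -> : Q`_k = 0 by rewrite coefMXn ltnS k1.
    by rewrite normc0 mul0r mulr0.
  have e1 : seminorm X q (a *: (iter p T (cauchy_power u m.+2) - tgt t)) <=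
      q.+1%:R^-1 * normc a.
    by rewrite seminormZ// mulrC ler_wpM2r ?normc_ge0// ltW.
  have e2 : seminorm X q (a *: (tgt t - a^-1 *: x1)) <= q.+1%:R^-1 * normc a.
    by rewrite seminormZ// mulrC ler_wpM2r ?normc_ge0// ltW.
  have e3 : seminorm X q (a *: (iter p T (cauchy_power u m.+2) - tgt t) +
      a *: (tgt t - a^-1 *: x1)) <= q.+1%:R^-1 * normc a + q.+1%:R^-1 * normc a.
    by apply: le_trans (lerD e1 e2); apply: seminormD; exact: carrierZ.
  apply: le_trans (lerD sum_le e3) _.
  by rewrite -!mulrDr ler_wpM2l ?invr_ge0// /C mulrDl mul1r -[leLHS]addr0 lerD.
apply: (@lt_le_trans _ _ (delta (m, q, t))%:E); first by rewrite lte_fin.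
apply: upper_density_ge => N0.
have [N [N0N _ Nfreq]] := ufreq (m, q, t) N0.
by exists N => //; apply: le_trans Nfreq _; apply: frequency_mono => p _; exact: hitU.
Qed.
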